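(* For every real $k\ge 4$, we have $\mathrm{m}(P_k)=\mathrm{m}(Q_{k+2})$, where $$P_k(x,y)=(x^2+x+1)y^2+kx(x+1)y+x(x^2+x+1)$$ and $$Q_k(x,y)=(x^2+x+1)y^2+(x^4+kx^3+(2k-4)x^2+kx+1)y+x^2(x^2+x+1).$$
   Context: For a nonzero Laurent polynomial $F(x,y)\in\mathbb C[x^{\pm1},y^{\pm1}]$, its (logarithmic) Mahler measure is $$\mathrm{m}(F)=\frac1{(2\pi i)^2}\iint_{|x|=|y|=1}\log|F(x,y)|\,\frac{dx}{x}\,\frac{dy}{y}.$$ *)

(* Defs.v *)
From HB Require Import structures.
From mathcomp Require Import all_boot all_order all_algebra.
From mathcomp Require Import all_classical all_reals all_analysis.
From mathcomp Require complex.
Import complex.ComplexField.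
Set Implicit Arguments. Unset Strict Implicit. Unset Printing Implicit Defensive.
Import Order.TTheory GRing.Theory Num.Theory.
Local Open Scope ring_scope.
Local Open Scope classical_set_scope.

Notation C R := (complex.complex R).

Definition cabs (R : realType) (z : C R) : R :=
  Num.sqrt (complex.Re z ^+ 2 + complex.Im z ^+ 2).

Definition expi (R : realType) (t : R) : C R := complex.Complex (cos t) (sin t).

(* Bivariate polynomials F(x,y) in C[x][y]: y is the outer variable, x the inner. *)
Definition eval2 (R : realType) (F : {poly {poly C R}}) (x y : C R) : C R :=
  (F.[y%:P]).[x].

Definition mahler (R : realType) (F : {poly {poly C R}}) : \bar R :=
  (((2 * pi) ^+ 2)^-1)%:E *
  (\int[lebesgue_measure]_(t in `[0%R, (2 * pi)%R]%classic)
     (\int[lebesgue_measure]_(s in `[0%R, (2 * pi)%R]%classic)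
        (ln (cabs (eval2 F (expi s) (expi t))))%:E))%E.

Definition Xx (R : realType) : {poly {poly C R}} := ('X : {poly C R})%:P.
Definition Yy (R : realType) : {poly {poly C R}} := 'X.

Definition cst (R : realType) (k : R) : {poly {poly C R}} :=
  (complex.Complex k 0 : C R)%:P%:P.

Definition Pk (R : realType) (k : R) : {poly {poly C R}} :=
  let x := Xx R in let y := Yy R in
  (x ^+ 2 + x + 1) * y ^+ 2 + cst k * x * (x + 1) * y + x * (x ^+ 2 + x + 1).

Definition Qk (R : realType) (k : R) : {poly {poly C R}} :=
  let x := Xx R in let y := Yy R in
  (x ^+ 2 + x + 1) * y ^+ 2
  + (x ^+ 4 + cst k * x ^+ 3 + cst (2 * k - 4) * x ^+ 2 + cst k * x + 1) * y
  + x ^+ 2 * (x ^+ 2 + x + 1).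

(* Main.v *)
Require Import Defs.
From HB Require Import structures.
From mathcomp Require Import all_boot all_order all_algebra.
From mathcomp Require Import all_classical all_reals all_analysis.
From mathcomp Require complex.
From mathcomp Require Import measurable_realfun.
From mathcomp Require Import ring lra.
Import complex.ComplexField.
Import Order.TTheory GRing.Theory Num.Theory.
Import numFieldNormedType.Exports.
Local Open Scope classical_set_scope.
Local Open Scope ring_scope.
Set Implicit Arguments.
Unset Strict Implicit.
Unset Printing Implicit Defensive.

(* Put c = cos (s / 2), a = 4 c^2 - 1, b_P = k c and
   b_Q = 8 c^4 + (2 k - 4) c^2 - 1. On the torus x = e^(is), y = e^(it), up to a
   factor of modulus one, both P_k and Q_(k+2) have the form
   2 a cos(t - phi(s)) + 2 b, with the same a and with b = b_P, respectively
   b = b_Q. By Jensen's formula, integrating log |.| over t gives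
   J(a, b) = log (max(|a|, |b|) + sqrt(b^2 - a^2)), where the square root is 0
   when |b| <= |a|. Differentiating in k produces complete elliptic integrals of
   c / sqrt(b_P^2 - a^2) and 2 c^2 / sqrt(b_Q^2 - a^2) over s, which a
   substitution brings to the same Legendre form. Hence the difference of the
   two Mahler measures is constant on [4, +oo[. As k tends to infinity,
   J(a, b_P) - J(a, b_Q) tends to - log (2 c), whose mean is zero, so the
   constant is 0. *)

(** The integrands are singular: the logarithms where the polynomial vanishes on the torus, the
    derivatives in k like an inverse square root where |b| = |a|. Differentiation under the integral
    sign is therefore avoided: the increment of J from k to K is the integral over ]k, K[ of a
    nonnegative derivative, and Tonelli's theorem exchanges it with the integral over s. Let p and
    -q be the roots of 4 x^2 + k x - 1, so that p q = 1/4. Then b_P^2 - a^2 = 16 (q^2 - c^2) (c^2 -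
    p^2) and b_Q^2 - a^2 = 64 c^2 (c^2 - p) (c^2 + q) (c^2 - 1 + q - p). The substitution tan x = la
    sin(s/2) / sqrt(c^2 - r^2), with (la, r) = (1, p) for P and (sqrt((q - 1) / (q - p)), sqrt p)
    for Q, turns both derivatives into the same multiple of the integral of 1 / sqrt((q^2 - p^2)
    sin^2 x + (q^2 - 1) cos^2 x) over ]-pi/2, pi/2[. The assumption k >= 4 says q - p >= 1, which
    makes the factor c^2 - 1 + q - p positive. *)

(** * Translation invariance and integrals over a period *)

Section Periodic.
Context {R : realType}.
Local Notation mu := (@lebesgue_measure R).
Local Open Scope ereal_scope.

(** Lebesgue measure is determined by its values on half-open intervals, so comparing lengths is
    enough. *)
Lemma lebesgue_measure_shift (a : R) (A : set R) : measurable A ->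
  pushforward mu ((fun x : R => (x + a)%R) : _ -> measurableTypeR R) A = mu A.
Proof.
move=> mA.
apply/esym/lebesgue_measure_unique => //; first exact: measurable_funD.
move=> mphi _ [[b c]] _ <-; rewrite /pushforward/=.
rewrite [X in _ = lebesgue_measure X](_ : _ = [set` `](b - a)%R, (c - a)%R]]); last first.
  by apply/seteqP; split => x /=; rewrite !in_itv/= ltrBlDr lerBrDr.
rewrite !lebesgue_measure_itv/= !lte_fin ltrD2r -!EFinD.
by case: ifP => // _; congr EFin; ring.
Qed.

Lemma integral_shift (a : R) (D : set R) (f : R -> \bar R) :
  measurable D -> measurable_fun D f ->
  \int[mu]_(x in [set x | D (x + a)%R]) f (x + a)%R = \int[mu]_(x in D) f x.
Proof.
move=> mD.
wlog f0 : f / forall x, 0 <= f x.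
  move=> H mf; rewrite [LHS]integralE [RHS]integralE; congr (_ - _).
  - rewrite -(H f^\+)//; last exact: measurable_funepos.
    by apply: eq_integral => x _; rewrite !funeposE.
  - rewrite -(H f^\-)//; last exact: measurable_funeneg.
    by apply: eq_integral => x _; rewrite !funenegE.
move=> mf.
have mphi : measurable_fun [set: measurableTypeR R]
    ((fun x => (x + a)%R) : measurableTypeR R -> measurableTypeR R).
  exact: measurable_funD.
rewrite -[LHS](ge0_integral_pushforward mphi mu mD mf)//.
apply: eq_measure_integral => A mA _; exact: lebesgue_measure_shift.
Qed.

(** The interval is cut at [T], and the piece beyond [T] moves back by one period. Half-open
    intervals make the pieces disjoint; positive and negative parts make additivity available
    without integrability. *)
Lemma integral_periodic_co (T a : R) (f : R -> \bar R) :
  measurable_fun setT f -> (forall x, f (x + T)%R = f x) -> (0 <= a <= T)%R ->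
  \int[mu]_(x in `[0%R, T[) f (x + a)%R = \int[mu]_(x in `[0%R, T[) f x.
Proof.
move=> mf pf /andP[a0 aT].
have -> : \int[mu]_(x in `[0%R, T[) f (x + a)%R = \int[mu]_(x in `[a, (T + a)%R[) f x.
  rewrite -(@integral_shift a `[a, (T + a)%R[%classic f)//; last exact: measurable_funTS.
  congr (integral _ _ _); apply/seteqP; split => x /=; rewrite !in_itv/= => /andP[? ?];
    apply/andP; split; lra.
have splitE (g : R -> \bar R) (u v w : R) : (u <= v <= w)%R -> measurable_fun setT g ->
    (forall x, 0 <= g x) ->
    \int[mu]_(x in `[u, w[) g x =
    \int[mu]_(x in `[u, v[) g x + \int[mu]_(x in `[v, w[) g x.
  move=> /andP[uv vw] mg g0.
  rewrite -ge0_integral_setU//=; first last.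
  - apply/disj_setPS => x /= []; rewrite !in_itv/= => /andP[_ xv] /andP[vx _].
    by move: (lt_le_trans xv vx); rewrite ltxx.
  - exact: measurable_funTS.
  congr (integral _ _ _); apply/seteqP; split => x /=; rewrite !in_itv/=.
  - by move=> /andP[ux xw]; have [xv|vx] := ltP x v; [left|right]; apply/andP.
  - by case=> /andP[? ?]; apply/andP; split; lra.
suff H g : measurable_fun setT g -> (forall x, g (x + T)%R = g x) ->
    (forall x, 0 <= g x) ->
    \int[mu]_(x in `[a, (T + a)%R[) g x = \int[mu]_(x in `[0%R, T[) g x.
  rewrite [LHS]integralE [RHS]integralE; congr (_ - _).
  - apply: H => //; first exact: measurable_funepos.
    by move=> x; rewrite !funeposE pf.
  - apply: H => //; first exact: measurable_funeneg.
    by move=> x; rewrite !funenegE pf.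
move=> mg pg g0.
rewrite (splitE _ _ T _)//; last by apply/andP; split; lra.
rewrite [RHS](splitE _ _ a _)//; last by apply/andP; split; lra.
rewrite addeC; congr (_ + _).
rewrite -(@integral_shift T `[T, (T + a)%R[%classic g)//; last exact: measurable_funTS.
rewrite (_ : [set x | _] = `[0%R, a[%classic); last first.
  apply/seteqP; split => x /=; rewrite !in_itv/= => /andP[? ?];
    apply/andP; split; lra.
by apply: eq_integral => x _; rewrite pg.
Qed.

Lemma integral_periodic (T a : R) (f : R -> \bar R) :
  measurable_fun setT f -> (forall x, f (x + T)%R = f x) -> (0 <= a <= T)%R ->
  \int[mu]_(x in `[0%R, T]) f (x + a)%R = \int[mu]_(x in `[0%R, T]) f x.
Proof.
move=> mf pf aT.
rewrite -[LHS]integral_itv_bndo_bndc; last first.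
  by apply: measurable_funTS; apply: measurableT_comp => //; exact: measurable_funD.
rewrite -[RHS]integral_itv_bndo_bndc; last exact: measurable_funTS.
exact: integral_periodic_co.
Qed.

End Periodic.

(** * Fundamental theorem of calculus with singular end points *)

Section SingularFTC.
Context {R : realType}.
Local Notation mu := (@lebesgue_measure R).

Lemma integral_support (D E : set R) (f : R -> \bar R) : E `<=` D ->
  (forall x, D x -> ~ E x -> f x = 0%E) ->
  (\int[mu]_(x in D) f x = \int[mu]_(x in E) f x)%E.
Proof.
move=> ED f0; rewrite integral_mkcond [RHS]integral_mkcond.
congr (integral _ _ _); apply/funext => x; rewrite !patchE.
have [xE|xE] := boolP (x \in E).
  by rewrite mem_set//; apply: ED; exact: set_mem.
case: ifPn => // xD; apply: f0; first exact: set_mem.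
by move=> Ex; move/negP: xE; apply; exact: mem_set.
Qed.

(** The integrand may blow up at both ends; only the primitive needs limits there. The compact case
    is applied on intervals exhausting []u, v[], and nonnegativity allows monotone convergence, so
    integrability is a consequence and not an assumption. *)
Lemma ge0_FTC_oo (f F : R -> R) (u v A B : R) : u < v ->
  (forall x, u < x < v -> 0 <= f x) ->
  (forall x, u < x < v -> {for x, continuous f}) ->
  (forall x, u < x < v -> is_derive x 1 F (f x)) ->
  F x @[x --> u^'+] --> A -> F x @[x --> v^'-] --> B ->
  (\int[mu]_(x in `]u, v[) (f x)%:E = (B - A)%:E)%E.
Proof.
move=> uv f0 cf dF FA FB.
(* The denominator starts at 2 so that the first compact interval already has positive length. *)
pose d (n : nat) := (v - u) / 2 / n.+2%:R.
have d0 n : 0 < d n by rewrite divr_gt0// divr_gt0//; lra.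
have dlt n : d n < (v - u) / 2.
  by rewrite ltr_pdivrMr// ltr_pMr ?ltr1n//; lra.
pose S n : set R := `[u + d n, v - d n]%classic.
have nd : nondecreasing_seq S.
  move=> m n mn; apply/subsetPset => x; rewrite /S/= !in_itv/= => /andP[ux xv].
  have : d n <= d m.
    rewrite /d ler_wpM2l//; first by lra.
    by rewrite lef_pV2 ?posrE// ler_nat.
  by move=> ?; apply/andP; split; lra.
have dcvg : d n @[n --> \oo] --> (0 : R).
  rewrite /d -[X in _ --> X](mulr0 ((v - u) / 2)).
  apply: cvgMl_tmp; apply/cvgrPdist_le => e e0; near=> n.
  rewrite sub0r normrN ger0_norm//.
  apply: (@le_trans _ _ n.+1%:R^-1); first by rewrite lef_pV2 ?posrE// ler_nat.
  apply: ltW; near: n; exact: (near_infty_natSinv_lt (PosNum e0)).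
have Scup : \bigcup_n S n = `]u, v[%classic.
  apply/seteqP; split => x /=.
    move=> [n _]; rewrite /S/= !in_itv/= => /andP[? ?].
    by have := d0 n; move=> ?; apply/andP; split; lra.
  rewrite in_itv/= => /andP[ux xv].
  pose e := Num.min (x - u) (v - x).
  have e0 : 0 < e by rewrite /e lt_min; apply/andP; split; lra.
  move/cvgrPdist_lt : dcvg => /(_ _ e0) [N _ /(_ N (leqnn N))].
  rewrite sub0r normrN ger0_norm; last exact/ltW.
  rewrite /e lt_min => /andP[? ?]; exists N => //=; rewrite /S/= in_itv/=.
  by apply/andP; split; lra.
have inS n x : u + d n <= x <= v - d n -> u < x < v.
  by move=> /andP[? ?]; have := d0 n; move=> ?; apply/andP; split; lra.
have SE n : (\int[mu]_(x in S n) (f x)%:E = (F (v - d n) - F (u + d n))%:E)%E.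
  rewrite /S (@continuous_FTC2 _ f F)//.
  - by have := dlt n; lra.
  - apply: continuous_in_subspaceT => x; rewrite inE/= in_itv/= => xS.
    exact/cf/(inS n).
  - split.
    + move=> x; rewrite in_itv/= => /andP[? ?].
      have : u < x < v by apply: (inS n); rewrite !ltW.
      by move=> /dF[].
    + apply: cvg_at_right_filter.
      have /dF[dFx _] : u < u + d n < v.
        by have := d0 n; have := dlt n; move=> ? ?; apply/andP; split; lra.
      by apply/differentiable_continuous/derivable1_diffP.
    + apply: cvg_at_left_filter.
      have /dF[dFx _] : u < v - d n < v.
        by have := d0 n; have := dlt n; move=> ? ?; apply/andP; split; lra.
      by apply/differentiable_continuous/derivable1_diffP.
  - move=> x; rewrite in_itv/= => /andP[? ?].
    have : u < x < v by apply: (inS n); rewrite !ltW.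
    by move=> /dF dFx; rewrite derive1E derive_val.
have mf : measurable_fun `]u, v[ (EFin \o f).
  apply/measurable_EFinP; apply: open_continuous_measurable_fun => //.
  by move=> x; rewrite inE/= in_itv/=; exact: cf.
have SS n : S n `<=` `]u, v[ by rewrite -Scup; exact: bigcup_sup.
have : (\int[mu]_(x in S n) (f x)%:E @[n --> \oo] -->
    \int[mu]_(x in \bigcup_n S n) (f x)%:E)%E.
  apply: ge0_nondecreasing_set_cvg_integral => //.
  - by move=> n; exact: measurable_itv.
  - by move=> n; apply: measurable_funS mf.
  - by move=> n x /SS/=; rewrite in_itv/= lee_fin; exact: f0.
rewrite Scup.
suff h2 : ((F (v - d n) - F (u + d n))%:E @[n --> \oo] --> (B - A)%:E)%E.
  under [X in X @ \oo --> _ -> _]eq_fun do rewrite SE.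
  by move=> /cvg_unique; apply.
apply: cvg_EFin; first by near=> n.
apply: cvgB.
- move/cvg_at_leftP : FB; apply; split; first by move=> n; have := d0 n; lra.
  by rewrite -[X in _ --> X](subr0 v); apply: cvgB => //; exact: cvg_cst.
- move/cvg_at_rightP : FA; apply; split; first by move=> n; have := d0 n; lra.
  by rewrite -[X in _ --> X](addr0 u); apply: cvgD => //; exact: cvg_cst.
Unshelve. all: by end_near. Qed.

End SingularFTC.

(** * Integrable functions with a real value of the integral *)

Section HasIntegral.
Context {R : realType}.
Local Notation mu := (@lebesgue_measure R).

(** Integrability and value travel together, so that linear combinations of integrals are computed
    in [R] and not in the extended reals. *)
Definition has_integral (D : set R) (f : R -> R) (v : R) :=
  mu.-integrable D (EFin \o f) /\ (\int[mu]_(x in D) (f x)%:E = v%:E)%E.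

Lemma has_integralP (D : set R) (f : R -> R) : measurable D ->
  mu.-integrable D (EFin \o f) -> exists v, has_integral D f v.
Proof.
move=> mD fi; exists (fine (\int[mu]_(x in D) (f x)%:E)); split => //.
by rewrite fineK//; exact: integrable_fin_num.
Qed.

Lemma has_integral_unique (D : set R) (f : R -> R) (v w : R) :
  has_integral D f v -> has_integral D f w -> v = w.
Proof. by move=> [_ fv] [_]; rewrite fv => -[]. Qed.

Lemma has_integral_eq (D : set R) (f g : R -> R) (v : R) : measurable D ->
  (forall x, D x -> f x = g x) -> has_integral D f v -> has_integral D g v.
Proof.
move=> mD fg [fi fv]; split.
  apply: (@eq_integrable _ _ _ mu D mD (EFin \o f)) fi => x /set_mem Dx /=; by rewrite fg.
by rewrite -fv; apply: eq_integral => x /set_mem Dx; rewrite fg.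
Qed.

Lemma has_integralD (D : set R) (f g : R -> R) (v w : R) : measurable D ->
  has_integral D f v -> has_integral D g w ->
  has_integral D (fun x => f x + g x) (v + w).
Proof.
move=> mD [fi fv] [gi gw]; split.
  by apply: (@eq_integrable _ _ _ mu D mD ((EFin \o f) \+ (EFin \o g))%E); last exact: integrableD.
by rewrite EFinD -fv -gw -integralD_EFin.
Qed.

Lemma has_integralZ (D : set R) (f : R -> R) (v k : R) : measurable D ->
  has_integral D f v -> has_integral D (fun x => k * f x) (k * v).
Proof.
move=> mD [fi fv]; split.
  by apply: (@eq_integrable _ _ _ mu D mD (fun x => k%:E * (EFin \o f) x)%E); last exact: integrableZl.
by rewrite EFinM -fv -integralZl//.
Qed.

Lemma has_integralN (D : set R) (f : R -> R) (v : R) : measurable D ->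
  has_integral D f v -> has_integral D (fun x => - f x) (- v).
Proof.
move=> mD /(has_integralZ (-1) mD); rewrite mulN1r.
by apply: has_integral_eq => // x _; rewrite mulN1r.
Qed.

Lemma has_integral_cst (a b c : R) : a <= b ->
  has_integral `[a, b]%classic (fun=> c) (c * (b - a)).
Proof.
move=> ab; split.
  apply: continuous_compact_integrable; first exact: segment_compact.
  by apply: continuous_subspaceT => x; exact: cst_continuous.
rewrite integral_cst//= lebesgue_measure_itv/= lte_fin.
move: ab; rewrite le_eqVlt => /predU1P[->|->]; last by rewrite -EFinD -EFinM.
by rewrite ltxx subrr mulr0 mule0.
Qed.

Lemma continuous_has_integral (a b : R) (f : R -> R) :
  (forall x : R, {for x, continuous f}) -> exists v, has_integral `[a, b]%classic f v.
Proof.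
move=> cf; apply: has_integralP => //.
apply: continuous_compact_integrable; first exact: segment_compact.
exact: continuous_subspaceT.
Qed.

Lemma le_has_integral (D : set R) (f g : R -> R) (v w : R) : measurable D ->
  (forall x, D x -> f x <= g x) -> has_integral D f v -> has_integral D g w ->
  v <= w.
Proof.
move=> mD fg [fi fv] [gi gw]; rewrite -lee_fin -fv -gw.
by apply: le_integral => // x /set_mem Dx; rewrite lee_fin fg.
Qed.

(** Meant for identities between logarithms that fail at the finitely many zeros of their arguments,
    where [ln] takes the value 0. *)
Lemma has_integral_ae (D N : set R) (f g : R -> R) (v : R) : measurable D ->
  measurable_fun D g -> countable N -> (forall x, D x -> ~ N x -> f x = g x) ->
  has_integral D f v -> has_integral D g v.
Proof.
move=> mD mg cN fg [fi fv].
have mf : measurable_fun D f by move/measurable_int : fi => /measurable_EFinP.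
have mN : measurable N by apply: countable_measurable.
have N0 : mu N = 0%E by exact: countable_lebesgue_measure0.
split; last first.
  rewrite -fv; apply/esym; apply: ae_eq_integral => //; try exact/measurable_EFinP.
  exists N; split => // x /=; apply: contra_notP => Nx Dx.
  by rewrite fg.
apply/integrableP; split; first exact/measurable_EFinP.
move/integrableP : fi => [_]; apply: le_lt_trans.
rewrite le_eqVlt; apply/orP; left; apply/eqP.
apply: ae_eq_integral => //; try by apply: measurableT_comp => //; exact/measurable_EFinP.
exists N; split => // x /=; apply: contra_notP => Nx Dx.
by rewrite fg.
Qed.

Lemma has_integral_shift (T a v : R) (f : R -> R) :
  measurable_fun setT f -> (forall x, f (x + T) = f x) -> 0 <= a <= T ->
  has_integral `[0, T]%classic f v ->
  has_integral `[0, T]%classic (fun x : R => f (x + a)) v.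
Proof.
move=> mf pf aT [fi fv].
have mfa : measurable_fun setT (fun x : R => f (x + a)).
  by apply: measurableT_comp => //; exact: measurable_funD.
split.
  apply/integrableP; split; first by apply/measurable_EFinP; exact: measurable_funTS.
  rewrite /= (integral_periodic (f := fun x => `|(f x)%:E|%E))//.
  - by move/integrableP : fi => [].
  - by apply: measurableT_comp => //; exact/measurable_EFinP.
  - by move=> x; rewrite pf.
rewrite (integral_periodic (f := fun x => (f x)%:E))//.
  exact/measurable_EFinP.
by move=> x; rewrite pf.
Qed.

(** Substituting [y = 2 x] gives half of the integral of [f] over [[0, 2 T]], which consists of two
    periods. *)
Lemma has_integral_double (T v : R) (f : R -> R) : 0 < T ->
  (forall x : R, {for x, continuous f}) -> (forall x, f (x + T) = f x) ->
  has_integral `[0, T]%classic f v ->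
  has_integral `[0, T]%classic (fun x : R => f (2 * x)) v.
Proof.
move=> T0 cf pf fv.
have c2 : forall x : R, {for x, continuous (fun x : R => f (2 * x))}.
  move=> x; have : {for x, continuous (f \o ( *%R 2))} by
    apply: continuous_comp; [exact: mulrl_continuous|exact: cf].
  by [].
have [w fw] := continuous_has_integral 0 T c2.
suff -> : v = w by [].
have mf : measurable_fun setT f by apply: continuous_measurable_fun => x; exact: cf.
have d2 (x : R) : is_derive x 1 ( *%R 2) 2.
  by apply: (is_derive_eq (is_deriveZ _ _)); rewrite [LHS]mulr1.
have d2E : derive1 (( *%R 2) : R -> R) = cst 2.
  by apply/funext => x; rewrite derive1E derive_val.
have := @integration_by_substitution_increasing R ( *%R 2) f 0 T (ltW T0).
rewrite d2E.
have hom : {in `[0, T] &, {homo ( *%R (2:R)) : x y / x < y}}.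
  by move=> x y _ _ xy; rewrite ltr_pM2l.
move=> /(_ hom) H.
have {H} : (\int[mu]_(x in `[(2 * 0)%R, (2 * T)%R]) (f x)%:E =
  \int[mu]_(x in `[0%R, T]) (f (2 * x) * 2)%:E)%E.
  rewrite H//.
  - by move=> x _; exact: cst_continuous.
  - exact: is_cvg_cst.
  - exact: is_cvg_cst.
  - split.
    + by move=> x _.
    + by apply: cvg_at_right_filter; exact: mulrl_continuous.
    + by apply: cvg_at_left_filter; exact: mulrl_continuous.
  - by apply: continuous_subspaceT => x; exact: cf.
rewrite mulr0.
have -> : (\int[mu]_(x in `[0%R, T]) (f (2 * x) * 2)%:E = (2 * w)%:E)%E.
  have [_ <-] := has_integralZ 2 (measurable_itv _) fw.
  by apply: eq_integral => x _; rewrite mulrC.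
have fi : mu.-integrable `[0, 2 * T]%classic (EFin \o f).
  have [u []//] := continuous_has_integral 0 (2 * T) cf.
have -> : `[0, (2 * T)]%classic = `[0, T]%classic `|` `]T, (2 * T)]%classic.
  apply/seteqP; split => x /=; rewrite !in_itv/=.
    by move=> /andP[? ?]; have [?|?] := leP x T; [left|right]; apply/andP.
  by case=> /andP[? ?]; apply/andP; split; lra.
rewrite integral_setU_EFin//=; last 2 first.
- exact: measurable_funTS.
- apply/disj_setPS => x /= []; rewrite !in_itv/= => /andP[_ xv] /andP[vx _].
  by move: (lt_le_trans vx xv); rewrite ltxx.
have -> : (\int[mu]_(x in `]T, (2 * T)%R]) (f x)%:E = v%:E)%E.
  rewrite integral_itv_obnd_cbnd; last by apply/measurable_EFinP; exact: measurable_funTS.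
  rewrite -(@integral_shift _ T `[T, (2 * T)%R]%classic (EFin \o f))//; last first.
    by apply/measurable_EFinP; exact: measurable_funTS.
  case: fv => _ <-; rewrite (_ : [set x | _] = `[0%R, T]%classic).
    by apply: eq_integral => x _ /=; rewrite pf.
  by apply/seteqP; split => x /=; rewrite !in_itv/= => /andP[? ?];
    apply/andP; split; lra.
case: (fv) => _ -> []; lra.
Qed.

End HasIntegral.

(** * Jensen's formula *)

Section Jensen.
Context {R : realType}.
Local Notation mu := (@lebesgue_measure R).
Local Notation I := (`[0, (2 * pi : R)]%classic).

Lemma cosD2pi_mul (x : R) : cos (x + 2 * pi) = cos x.
Proof. by rewrite mulr_natl cosD2pi. Qed.

Lemma twopi_gt0 : 0 < 2 * pi :> R.
Proof. by rewrite mulr_gt0// pi_gt0. Qed.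

Lemma is_derive1_continuous (f : R -> R) (x d : R) :
  is_derive x 1 f d -> {for x, continuous f}.
Proof. by move=> [df _]; apply/differentiable_continuous/derivable1_diffP. Qed.

Lemma continuous_ln_comp (f : R -> R) (x : R) :
  {for x, continuous f} -> 0 < f x -> {for x, continuous (fun y => ln (f y))}.
Proof.
move=> cf fx; have : {for x, continuous (@ln R \o f)} by
  apply: continuous_comp => //; exact: continuous_ln.
by [].
Qed.

(** For real [z] this is the logarithm of |1 + z e^(it)|^2. *)
Definition poisson_log (z t : R) := ln (1 + z ^+ 2 + 2 * z * cos t).

Lemma poisson_arg_ge (z t : R) : (1 - `|z|) ^+ 2 <= 1 + z ^+ 2 + 2 * z * cos t.
Proof.
have : `|z * cos t| <= `|z|.
  by rewrite normrM ler_piMr// ler_norml cos_geN1 cos_le1.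
rewrite ler_norml => /andP[h _].
rewrite sqrrB expr1n mul1r real_normK ?num_real//.
rewrite -mulrA mulr_natl; lra.
Qed.

Lemma poisson_arg_gt0 (z t : R) : `|z| < 1 -> 0 < 1 + z ^+ 2 + 2 * z * cos t.
Proof.
move=> z1; apply: lt_le_trans (poisson_arg_ge z t).
by rewrite exprn_gt0// subr_gt0.
Qed.

Lemma continuous_poisson_log (z t : R) : `|z| < 1 ->
  {for t, continuous (poisson_log z)}.
Proof.
move=> z1.
apply: continuous_ln_comp; last exact: poisson_arg_gt0.
exact: is_derive1_continuous.
Qed.

(** Translation by [pi] changes the sign of the cosine, which amounts to changing the sign of
    [z]. *)
Lemma poisson_log_has_integralN (z v : R) : `|z| < 1 ->
  has_integral I (poisson_log z) v -> has_integral I (poisson_log (- z)) v.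
Proof.
move=> z1 zv.
have -> : poisson_log (- z) = (fun t => poisson_log z (t + pi)).
  by apply/funext => t; rewrite /poisson_log cosDpi sqrrN; congr ln; ring.
apply: (has_integral_shift _ _ _ zv).
- by apply: continuous_measurable_fun => t; exact: continuous_poisson_log.
- by move=> x; rewrite /poisson_log cosD2pi_mul.
- by have := pi_gt0 R; move=> ?; apply/andP; split; lra.
Qed.

(* The factorization of [1 - z^2 w^2] and the invariance of the measure under
   [w -> w^2] double the integral when [z] is squared; iterating forces it to be 0. *)
Lemma poisson_log_double (z v w : R) : `|z| < 1 ->
  has_integral I (poisson_log z) v -> has_integral I (poisson_log (z ^+ 2)) w ->
  w = 2 * v.
Proof.
move=> z1 zv zw.
have z21 : `|z ^+ 2| < 1 by rewrite normrX expr_lt1.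
have z21N : `|- z ^+ 2| < 1 by rewrite normrN.
have := has_integralD (measurable_itv _) zv (poisson_log_has_integralN z1 zv).
have {}zw := poisson_log_has_integralN z21 zw.
have := has_integral_double twopi_gt0 (fun x => @continuous_poisson_log _ x z21N) _ zw.
move=> /(_ (fun x => congr1 (fun c => ln (1 + _ + _ * c)) (cosD2pi_mul x))) h1 h2.
rewrite -[RHS]/(2 * v) mulr_natl mulr2n.
apply: has_integral_unique h1 _; apply: has_integral_eq h2 => // t _.
rewrite /poisson_log -lnM ?posrE ?poisson_arg_gt0 ?normrN//; congr ln.
have -> : cos (2 * t) = 2 * cos t ^+ 2 - 1 by rewrite mulr_natl cos_mulr2n; ring.
ring.
Qed.

(** Repeated squaring keeps [z] in the disc of radius [|z|], where the integrals are bounded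
    uniformly, whereas each squaring doubles the value. *)
Lemma poisson_log_has_integral (z : R) : `|z| < 1 ->
  has_integral I (poisson_log z) 0.
Proof.
move=> z1.
have hI y : `|y| <= `|z| -> exists v, has_integral I (poisson_log y) v.
  move=> yz; apply: continuous_has_integral => x; apply: continuous_poisson_log.
  exact: le_lt_trans z1.
have r0 : 0 < (1 - `|z|) ^+ 2 by rewrite exprn_gt0// subr_gt0.
(* On the disc of radius [|z|] the argument of the logarithm lies between [(1 - |z|)^2] and 4. *)
pose M := `|ln ((1 - `|z|) ^+ 2)| + ln 4.
have ln4 : 0 <= ln 4 :> R by apply: ln_ge0; lra.
have bound (y v : R) : `|y| <= `|z| -> has_integral I (poisson_log y) v ->
    `|v| <= M * (2 * pi - 0).
  move=> yz yv.
  have hM (t : R) : `|poisson_log y t| <= M.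
    have h1 : (1 - `|z|) ^+ 2 <= 1 + y ^+ 2 + 2 * y * cos t.
      apply: le_trans (poisson_arg_ge y t).
      by rewrite ler_pXn2r// ?nnegrE; lra.
    have h2 : 1 + y ^+ 2 + 2 * y * cos t <= 4.
      have : `|y * cos t| <= `|y|.
        by rewrite normrM ler_piMr// ler_norml cos_geN1 cos_le1.
      have y1 : `|y| <= 1 by apply: le_trans yz (ltW _).
      rewrite ler_norml => /andP[_ h].
      have : y ^+ 2 <= 1 by rewrite -real_normK ?num_real// expr_le1.
      by rewrite -mulrA; lra.
    have p0 := lt_le_trans r0 h1.
    have := ler_norm (- ln ((1 - `|z|) ^+ 2)); rewrite normrN => h3.
    rewrite ler_norml /M; apply/andP; split.
      apply: (@le_trans _ _ (ln ((1 - `|z|) ^+ 2))); first by lra.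
      by rewrite ler_ln ?posrE.
    apply: (@le_trans _ _ (ln 4)); first by rewrite ler_ln ?posrE.
    by rewrite lerDr.
  have T0 := ltW twopi_gt0.
  rewrite ler_norml -mulNr; apply/andP; split.
    apply: le_has_integral (has_integral_cst (- M) T0) yv => // t _.
    by have := hM t; rewrite ler_norml => /andP[].
  apply: le_has_integral yv (has_integral_cst M T0) => // t _.
  by have := hM t; rewrite ler_norml => /andP[].
have iter n : forall y v : R, `|y| <= `|z| -> has_integral I (poisson_log y) v ->
    `|v| * 2 ^+ n <= M * (2 * pi - 0).
  elim: n => [|n IH] y v yz yv; first by rewrite expr0 mulr1; exact: bound yv.
  have y1 : `|y| < 1 by exact: le_lt_trans z1.
  have y2z : `|y ^+ 2| <= `|z|.
    apply: le_trans yz; rewrite normrX expr2 ler_piMr//; exact: ltW.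
  have [w yw] := hI _ y2z.
  have := IH _ _ y2z yw; rewrite (poisson_log_double y1 yv yw).
  by rewrite normrM ger0_norm// exprS mulrCA mulrA.
have [v zv] := hI z (lexx _).
suff v0 : v = 0 by rewrite v0 in zv.
apply/eqP/negPn/negP => vn0.
have vgt0 : 0 < `|v| by rewrite normr_gt0.
(* An integer above the ratio of the uniform bound to [|v|]; then [n < 2 ^ n] contradicts [iter]. *)
pose n := Num.bound `|M * (2 * pi - 0) / `|v| |.
have := iter n z v (lexx _) zv; apply/negP; rewrite -ltNge.
rewrite [ltRHS]mulrC -ltr_pdivrMr//.
apply: (@lt_trans _ _ n%:R).
  exact: le_lt_trans (ler_norm _) (archi_boundP (normr_ge0 _)).
by rewrite -natrX ltr_nat ltn_expl.
Qed.

(** With r = sqrt(b^2 - a^2) and z = a / (b + r), the argument factors as (b + r) (1 + z^2 + 2 z cos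
    t). Since |z| < 1, only the constant factor contributes to the integral. *)
Lemma jensen_gt (a b : R) : `|a| < b ->
  has_integral I (fun t => ln (2 * a * cos t + 2 * b))
    (ln (b + Num.sqrt (b ^+ 2 - a ^+ 2)) * (2 * pi)).
Proof.
move=> ab.
have b0 : 0 < b by exact: le_lt_trans ab.
set r := Num.sqrt _.
have r0 : 0 <= r by exact: sqrtr_ge0.
have r2 : r ^+ 2 = b ^+ 2 - a ^+ 2.
  rewrite sqr_sqrtr// subr_ge0 -(real_normK (num_real a)).
  by rewrite ler_pXn2r// ?nnegrE; exact: ltW.
have br0 : 0 < b + r by rewrite ltr_wpDr.
pose z := a / (b + r).
have z1 : `|z| < 1.
  by rewrite normrM normfV (gtr0_norm br0) ltr_pdivrMr// mul1r ltr_wpDr.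
have h := has_integralD (measurable_itv _)
  (has_integral_cst (ln (b + r)) (ltW twopi_gt0)) (poisson_log_has_integral z1).
rewrite subr0 addr0 in h.
apply: has_integral_eq h => // t _.
rewrite /poisson_log -lnM ?posrE ?poisson_arg_gt0//; congr ln.
have zE : z * (b + r) = a by rewrite /z divfK// gt_eqF.
have z2E : (b + r) * z ^+ 2 = b - r.
  apply: (mulIf (lt0r_neq0 br0)); rewrite -subr_sqr r2.
  by rewrite mulrAC -expr2 -exprMn mulrC zE; ring.
have -> : (b + r) * (1 + z ^+ 2 + 2 * z * cos t) =
  (b + r) + (b + r) * z ^+ 2 + 2 * (z * (b + r)) * cos t by ring.
by rewrite z2E zE; ring.
Qed.

(** The boundary case |a| = b = 1, with a logarithmic singularity at [pi]. It is the limit of the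
    cases b > 1 as b decreases to 1, by monotone convergence. *)
Lemma ln_1Dcos_has_integral :
  has_integral I (fun t : R => ln (2 + 2 * cos t)) 0.
Proof.
pose b n : R := 1 + n.+1%:R^-1.
have b1 n : `|1| < b n by rewrite normr1 /b ltrDl invr_gt0.
have b2 n : b n <= 2.
  have : n.+1%:R^-1 <= (1 : R) by rewrite invf_le1 ?ltr0n ?ler1n.
  by rewrite /b; move: (n.+1%:R^-1) => x ?; lra.
have bcvg : b n @[n --> \oo] --> (1 : R).
  rewrite /b -[X in _ --> X]addr0; apply: cvgD; first exact: cvg_cst.
  apply/cvgrPdist_le => e e0; near=> n.
  rewrite sub0r normrN ger0_norm//.
  apply: ltW; near: n; exact: (near_infty_natSinv_lt (PosNum e0)).
have bnd m n : (m <= n)%N -> b n <= b m.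
  by move=> mn; rewrite /b lerD2l lef_pV2 ?posrE// ler_nat.
(* At [pi] the limit argument is 0 and [ln 0 = 0], so pointwise convergence fails there; removing
   the point does not change the integrals. *)
pose D : set R := I `\ pi.
have mD : measurable D by exact: measurableD.
have c0 (t : R) : D t -> 0 < 2 + 2 * cos t.
  move=> [/=]; rewrite in_itv/= => /andP[t0 t2] tpi.
  have c1 := cos_geN1 t.
  rewrite lt_neqAle; apply/andP; split; last lra.
  apply/negP => /eqP /esym ct; apply: tpi.
  have {}ct : cos t = -1 by lra.
  have [tp|tp] := leP t pi.
    apply: cos_inj; rewrite ?in_itv/= ?t0 ?tp ?lexx ?pi_ge0//.
    by rewrite ct cospi.
  have : 2 * pi - t = pi.
    apply: cos_inj; rewrite ?in_itv/= ?lexx ?pi_ge0//.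
      by apply/andP; split; lra.
    by rewrite -opprB cosN cospi -ct -[in RHS](subrK (2 * pi) t) cosD2pi_mul.
  lra.
(* The constant 6 makes all functions nonnegative: [ln x < x], and [2 cos t + 2 b n <= 6] because
   [b n <= 2]. *)
pose f (t : R) := 6 - ln (2 + 2 * cos t).
pose g (n : nat) (t : R) := 6 - ln (2 * 1 * cos t + 2 * b n).
have gpos n t : 0 < 2 * 1 * cos t + 2 * b n.
  by have := cos_geN1 t; have := b1 n; rewrite normr1 => ? ?; lra.
have gI n : has_integral I (g n)
    (6 * (2 * pi - 0) - ln (b n + Num.sqrt (b n ^+ 2 - 1 ^+ 2)) * (2 * pi)).
  apply: has_integralD => //; first exact: (has_integral_cst 6 (ltW twopi_gt0)).
  by apply: has_integralN => //; exact: jensen_gt.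
have mlc : measurable_fun setT (fun t : R => ln (2 + 2 * cos t)).
  apply: measurableT_comp; first exact: measurable_ln.
  by apply: continuous_measurable_fun => t; exact: is_derive1_continuous.
have mf : measurable_fun setT f by apply: measurable_funB.
have mg n : measurable_fun setT (g n).
  apply: measurable_funB => //; apply: measurableT_comp; first exact: measurable_ln.
  by apply: continuous_measurable_fun => t; exact: is_derive1_continuous.
have gE (h : R -> R) : measurable_fun setT h ->
    (\int[mu]_(t in D) (h t)%:E = \int[mu]_(t in I) (h t)%:E)%E.
  move=> mh; apply: integral_setD1 => //.
  by apply/measurable_EFinP; exact: measurable_funTS.
have g0 n t : 0 <= g n t.
  rewrite /g subr_ge0; apply: le_trans (ltW (ln_sublinear (gpos n t))) _.
  by have := cos_le1 t; have := b2 n; move=> ? ?; lra.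
have gcvg t : D t -> (g n t)%:E @[n --> \oo] --> (f t)%:E.
  move=> Dt; apply: cvg_EFin; first by near=> n.
  apply: cvgB; first exact: cvg_cst.
  have -> : 2 + 2 * cos t = 2 * 1 * cos t + 2 * 1 by ring.
  apply: continuous_cvg.
    by apply: continuous_ln; have := c0 t Dt; lra.
  by apply: cvgD; [exact: cvg_cst|apply: cvgMl_tmp].
have h1 := @cvg_monotone_convergence _ _ _ mu D mD (fun n t => (g n t)%:E).
have {}h1 : (\int[mu]_(t in D) (g n t)%:E @[n --> \oo] -->
    \int[mu]_(t in D) (f t)%:E)%E.
  rewrite [X in _ --> X](_ : _ =
    \int[mu]_(t in D) (limn (fun n => (g n t)%:E)))%E; last first.
    apply: eq_integral => t /set_mem Dt; apply/esym/cvg_lim => //.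
    exact: gcvg.
  apply: h1.
  - by move=> n; apply/measurable_EFinP; apply: measurable_funTS; exact: mg.
  - by move=> n t _; rewrite lee_fin.
  - move=> t _ m n mn; rewrite lee_fin /g lerD2l lerN2 ler_ln ?posrE//.
    by rewrite lerD2l ler_pM2l// bnd.
have h2 : (\int[mu]_(t in D) (g n t)%:E @[n --> \oo] --> (6 * (2 * pi))%:E)%E.
  have gEn n : (\int[mu]_(t in D) (g n t)%:E)%E =
      (6 * (2 * pi - 0) - ln (b n + Num.sqrt (b n ^+ 2 - 1 ^+ 2)) * (2 * pi))%:E.
    by rewrite gE//; case: (gI n).
  under eq_fun do rewrite gEn.
  apply: cvg_EFin; first by near=> n.
  rewrite -[X in _ --> X]subr0; apply: cvgB; first by rewrite subr0; exact: cvg_cst.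
  rewrite -[X in _ --> X](mul0r (2 * pi)); apply: cvgMr_tmp.
  have -> : 0 = ln (1 + Num.sqrt (1 ^+ 2 - 1 ^+ 2)) :> R.
    by rewrite subrr sqrtr0 addr0 ln1.
  apply: continuous_cvg.
    by apply: continuous_ln; rewrite subrr sqrtr0 addr0.
  apply: cvgD => //; apply: continuous_cvg; first exact: sqrt_continuous.
  apply: cvgB; last exact: cvg_cst.
  by apply: (cvg_comp b (fun x : R => x ^+ 2) bcvg); exact: exprn_continuous.
have fI : (\int[mu]_(t in I) (f t)%:E = (6 * (2 * pi))%:E)%E.
  by rewrite -gE//; exact: cvg_unique h1 h2.
have f0 t : 0 <= f t.
  rewrite /f subr_ge0; have c1 := cos_geN1 t; have [->|cn] := eqVneq (cos t) (-1).
    by rewrite (_ : 2 + 2 * -1 = 0); [rewrite ln0|ring].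
  have p : 0 < 2 + 2 * cos t.
    have : -1 < cos t by rewrite lt_neqAle eq_sym cn.
    lra.
  by apply: le_trans (ltW (ln_sublinear p)) _; have := cos_le1 t; lra.
have fi : has_integral I f (6 * (2 * pi - 0)).
  split; last by rewrite subr0.
  apply/integrableP; split.
    by apply/measurable_EFinP; exact: measurable_funTS.
  under eq_integral => t _ do rewrite /= ger0_norm//.
  by rewrite fI ltry.
have := has_integralD (measurable_itv _) (has_integral_cst 6 (ltW twopi_gt0))
  (has_integralN (measurable_itv _) fi).
rewrite subrr; apply: has_integral_eq => // t _; rewrite /f; ring.
Unshelve. all: by end_near. Qed.

End Jensen.

(** * Jensen's formula for arbitrary real coefficients *)

Section JensenFormula.
Context {R : realType}.
Local Notation mu := (@lebesgue_measure R).
Local Notation I := (`[0, (2 * pi : R)]%classic).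

Lemma measurable_ln_smooth (f : R -> R) :
  (forall x, {for x, continuous f}) -> measurable_fun setT (fun x => ln (f x)).
Proof.
move=> cf; apply: measurableT_comp; first exact: measurable_ln.
by apply: continuous_measurable_fun => x; exact: cf.
Qed.

(** The range is the one covered by [t + al] and [t - al] for [t] in [[0, 2 pi]] and [al] in
    [[0, pi]]. *)
Lemma cos_eqN1 (x : R) : - pi <= x <= 3 * pi -> cos x = -1 ->
  [\/ x = - pi, x = pi | x = 3 * pi].
Proof.
move=> /andP[x1 x2] cx; have pi0 := pi_gt0 R.
have c0 : cos (x / 2) = 0.
  apply/eqP; rewrite -sqrf_eq0; apply/eqP.
  have : cos (x / 2 *+ 2) = cos x by congr cos; rewrite -mulr_natr; field.
  by rewrite cos_mulr2n cx -mulr_natr; lra.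
have s0 : sin (x / 2 - pi / 2) = 0 by rewrite sinBpihalf c0 oppr0.
pose y := x / 2 - pi / 2.
have yx : x = 2 * y + pi by rewrite /y; field.
have [y0|y0|y0] := ltgtP y 0.
- have [yp|yp] := leP y (- pi); first by apply: Or31; rewrite yx; lra.
  have : 0 < sin (- y) by apply: sin_gt0_pi; apply/andP; split; lra.
  by rewrite sinN s0 oppr0 ltxx.
- have [yp|yp] := leP pi y; first by apply: Or33; rewrite yx; lra.
  have : 0 < sin y by apply: sin_gt0_pi; apply/andP; split; lra.
  by rewrite s0 ltxx.
- by apply: Or32; rewrite yx; lra.
Qed.

(** The square of 2 cos t + 2 cos al is the product of 2 + 2 cos(t + al) and 2 + 2 cos(t - al), two
    translates of the boundary case, whose logarithms have integral 0. *)
Lemma ln_cosDcos_has_integral (a al : R) : a != 0 -> 0 <= al <= pi ->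
  has_integral I (fun t => ln `|2 * a * cos t + 2 * a * cos al|)
    (ln `|a| * (2 * pi)).
Proof.
move=> an0 /andP[a0 api]; have pi0 := pi_gt0 R.
have mh : measurable_fun setT (fun t : R => ln (2 + 2 * cos t)).
  by apply: measurable_ln_smooth => x; exact: is_derive1_continuous.
have per x : ln (2 + 2 * cos (x + 2 * pi)) = ln (2 + 2 * cos x) :> R.
  by rewrite cosD2pi_mul.
have h1 : has_integral I (fun t => ln (2 + 2 * cos (t + al))) 0.
  apply: (has_integral_shift mh per _ ln_1Dcos_has_integral).
  by apply/andP; split; lra.
(* The shift by [- al] is taken modulo the period, since shifts are required to lie in
   [[0, 2 pi]]. *)
have h2 : has_integral I (fun t => ln (2 + 2 * cos (t + (2 * pi - al)))) 0.
  apply: (has_integral_shift mh per _ ln_1Dcos_has_integral).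
  by apply/andP; split; lra.
have {h1 h2} := has_integralZ 2^-1 (measurable_itv _)
  (has_integralD (measurable_itv _) h1 h2).
rewrite addr0 mulr0 => h.
have {h} := has_integralD (measurable_itv _)
  (has_integral_cst (ln `|a|) (ltW twopi_gt0)) h.
rewrite addr0 subr0.
(* The four points are those where [t + al] or [t - al] can be an odd multiple of [pi], so that one
   of the factors vanishes. *)
apply: (@has_integral_ae _ _ [set pi - al; 3 * pi - al; al - pi; pi + al]) => //.
- apply: measurable_funTS; apply: measurableT_comp; first exact: measurable_ln.
  apply: measurableT_comp; first exact: normr_measurable.
  by apply: continuous_measurable_fun => x; exact: is_derive1_continuous.
- by apply: finite_set_countable; rewrite !finite_setU.
move=> t /=; rewrite in_itv/= => /andP[t0 t2] tN.
have -> : t + (2 * pi - al) = t - al + 2 * pi by ring.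
rewrite cosD2pi_mul.
have pos x : cos x <> -1 -> 0 < 2 + 2 * cos x.
  move=> cn; have : -1 < cos x by rewrite lt_neqAle cos_geN1 andbT eq_sym; exact/eqP.
  lra.
have p1 : 0 < 2 + 2 * cos (t + al).
  apply: pos => /cos_eqN1 []; first by apply/andP; split; lra.
  - by move=> ?; lra.
  - by move=> ?; apply: tN; left; left; left; lra.
  - by move=> ?; apply: tN; left; left; right; lra.
have p2 : 0 < 2 + 2 * cos (t - al).
  apply: pos => /cos_eqN1 []; first by apply/andP; split; lra.
  - by move=> ?; apply: tN; left; right; lra.
  - by move=> ?; apply: tN; right; lra.
  - by move=> ?; lra.
rewrite -lnM ?posrE//.
have E : (2 + 2 * cos (t + al)) * (2 + 2 * cos (t - al)) =
    `|2 * cos t + 2 * cos al| ^+ 2.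
  rewrite real_normK ?num_real// cosB cosD.
  have := cos2Dsin2 t; have := cos2Dsin2 al.
  move: (cos t) (cos al) (sin t) (sin al) => c d s e.
  move=> /(canRL (addKr _)) e2 /(canRL (addKr _)) s2.
  have -> : (2 + 2 * (c * d - s * e)) * (2 + 2 * (c * d + s * e)) =
    4 * ((1 + c * d) ^+ 2 - s ^+ 2 * e ^+ 2) by ring.
  by rewrite e2 s2; ring.
have q : 0 < `|2 * cos t + 2 * cos al|.
  rewrite lt_neqAle normr_ge0 andbT eq_sym.
  apply: contraTneq (mulr_gt0 p1 p2) => q0; by rewrite E q0 expr0n ltxx.
rewrite E lnXn// -[ln _ *+ 2]mulr_natl mulrA mulVf ?pnatr_eq0// mul1r.
have na0 : 0 < `|a| by rewrite normr_gt0.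
by rewrite -lnM ?posrE// -normrM; congr (ln `|_|); ring.
Qed.

(* For [|b| <= |a|] the square root is 0, and the value is [ln |a|]. *)
Definition jensen (a b : R) :=
  ln (Num.max `|a| `|b| + Num.sqrt (b ^+ 2 - a ^+ 2)).

Lemma jensenN (a b : R) : jensen a (- b) = jensen a b.
Proof. by rewrite /jensen normrN sqrrN. Qed.

(** Replacing (a, b) by (-a, -b) gives b >= 0. If b > |a| the argument never vanishes and
    [jensen_gt] applies; otherwise b = a cos al with al = acos(b / a), and the zeros lie on the
    circle. *)
Lemma jensen_has_integral (a b : R) : (a != 0) || (b != 0) ->
  has_integral I (fun t => ln `|2 * a * cos t + 2 * b|) (jensen a b * (2 * pi)).
Proof.
move=> ab0.
wlog b0 : a b ab0 / 0 <= b.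
  move=> H; have [/H|bneg] := leP 0 b; first exact.
  have -> : jensen a b = jensen (- a) (- b) by rewrite /jensen !normrN !sqrrN.
  have : has_integral I (fun t => ln `|2 * (- a) * cos t + 2 * (- b)|)
      (jensen (- a) (- b) * (2 * pi)).
    by apply: H; rewrite ?oppr_eq0// oppr_ge0 ltW.
  apply: has_integral_eq => // t _.
  by congr ln; rewrite -normrN; congr `|_|; ring.
have [ab|ba] := ltP `|a| b.
  rewrite /jensen (ger0_norm b0) (max_idPr (ltW ab)).
  apply: has_integral_eq (jensen_gt ab) => // t _.
  congr ln; rewrite ger0_norm//.
  have : `|a * cos t| <= `|a| by rewrite normrM ler_piMr// ler_norml cos_geN1 cos_le1.
  rewrite ler_norml -mulrA => /andP[? _]; lra.
have an0 : a != 0.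
  apply: contraTneq ab0 => a0; rewrite a0 normr0 in ba.
  by rewrite a0 eqxx/= negbK; apply/eqP/le_anti; rewrite ba b0.
have na0 : 0 < `|a| by rewrite normr_gt0.
have bb : -1 <= b / a <= 1.
  by rewrite -ler_norml normrM normfV ler_pdivrMr// mul1r (ger0_norm b0).
have [al ala cal] : exists2 al, 0 <= al <= pi & cos al = b / a.
  by exists (acos (b / a)); [case: (acos_def bb)|case: (acos_def bb)].
have := ln_cosDcos_has_integral an0 ala.
rewrite /jensen (ger0_norm b0) (max_idPl ba) ler0_sqrtr ?addr0; last first.
  by rewrite subr_le0 -(real_normK (num_real a)) ler_pXn2r ?nnegrE.
by rewrite cal; apply: has_integral_eq => // t _; congr (ln `|_|); field.
Qed.

End JensenFormula.

(** * Reduction of the Mahler measure to one variable *)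

Section TorusForm.
Context {R : realType}.
Local Notation mu := (@lebesgue_measure R).
Local Notation I := (`[0, (2 * pi : R)]%classic).
Local Notation emb r := (complex.Complex (r : R) 0 : C R).

Lemma mulcE (a b c d : R) : (complex.Complex a b : C R) * complex.Complex c d =
  complex.Complex (a * c - b * d) (a * d + b * c).
Proof. by []. Qed.

Lemma addcE (a b c d : R) : (complex.Complex a b : C R) + complex.Complex c d =
  complex.Complex (a + c) (b + d).
Proof. by []. Qed.

Lemma cabsM (z w : C R) : cabs (z * w) = cabs z * cabs w.
Proof.
case: z w => [a b] [c d]; rewrite mulcE /cabs/= -sqrtrM ?addr_ge0 ?sqr_ge0//.
by congr Num.sqrt; ring.
Qed.

Lemma cabs_expi (t : R) : cabs (expi t) = 1.
Proof. by rewrite /cabs/= cos2Dsin2 sqrtr1. Qed.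

Lemma cabs_emb (r : R) : cabs (emb r) = `|r|.
Proof. by rewrite /cabs/= expr0n addr0 sqrtr_sqr. Qed.

Lemma expiD (s t : R) : expi (s + t) = expi s * expi t.
Proof. by rewrite /expi mulcE cosD sinD; congr complex.Complex; ring. Qed.

Lemma embM (a b : R) : emb a * emb b = emb (a * b).
Proof. by rewrite mulcE; congr complex.Complex; ring. Qed.

Lemma embD (a b : R) : emb a + emb b = emb (a + b).
Proof. by rewrite addcE addr0. Qed.

Lemma expi_mul_cos (s : R) : expi s * emb (2 * cos s) = expi s ^+ 2 + 1.
Proof.
rewrite expr2 /expi !mulcE (_ : 1 = complex.Complex 1 0)// addcE.
have := cos2Dsin2 s; move: (cos s) (sin s) => c d cd.
congr complex.Complex; last by ring.
by lra.
Qed.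

Lemma emb1 : (1 : C R) = emb 1. Proof. by []. Qed.

(** With x = h^2, y = v h, A = h + 1/h and B = v + 1/v, one has x^2 + x + 1 = h^2 (A^2 - 1) and x +
    1 = h A, so the polynomial is h^4 v ((A^2 - 1) B + k A). The real numbers A and B are twice the
    cosines of s/2 and t - s/2. *)
Lemma cabs_Pk (k s t : R) : cabs (eval2 (Pk k) (expi s) (expi t)) =
  `|2 * (4 * cos (s / 2) ^+ 2 - 1) * cos (t - s / 2) + 2 * (k * cos (s / 2))|.
Proof.
have -> : eval2 (Pk k) (expi s) (expi t) =
  (expi s ^+ 2 + expi s + 1) * expi t ^+ 2
  + emb k * expi s * (expi s + 1) * expi t + expi s * (expi s ^+ 2 + expi s + 1).
  by rewrite /eval2 /Pk /Xx /Yy /cst !hornerE.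
set h := s / 2; set v := t - h.
have -> : expi s = expi h * expi h by rewrite -expiD; congr expi; rewrite /h; field.
have -> : expi t = expi v * expi h by rewrite -expiD; congr expi; rewrite /v; ring.
set A := emb (2 * cos h); set B := emb (2 * cos v).
have hA : expi h * A = expi h ^+ 2 + 1 by exact: expi_mul_cos.
have vB : expi v * B = expi v ^+ 2 + 1 by exact: expi_mul_cos.
rewrite [X in cabs X](_ : _ =
  expi h * expi h * (expi h * expi h) * expi v * ((A * A + emb (-1)) * B + emb k * A)).
  rewrite !cabsM !cabs_expi !mul1r /A /B !(embM, embD) cabs_emb.
  by congr `|_|; ring.
have -> : emb (-1) = - 1 by rewrite emb1; congr complex.Complex; rewrite oppr0.
set x := expi h in hA *; set y := expi v in vB *.
transitivity (x ^+ 2 * ((x * A) ^+ 2 - x ^+ 2) * (y * B) + emb k * x ^+ 3 * (x * A) * y).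
  by rewrite hA vB; ring.
by ring.
Qed.

(** With y = v x, A = x + 1/x and B = v + 1/v, the polynomial is x^3 v ((A + 1) B + A^2 - 2 + (k +
    2) A + 2 k). As A = 2 cos s = 4 c^2 - 2 for c = cos(s/2), the coefficient A + 1 equals the 4 c^2
    - 1 found for P; the shift of the parameter by 2 is absorbed here. *)
Lemma cabs_Qk (k s t : R) : cabs (eval2 (Qk (k + 2)) (expi s) (expi t)) =
  `|2 * (4 * cos (s / 2) ^+ 2 - 1) * cos (t - s) +
    2 * (8 * cos (s / 2) ^+ 4 + (2 * k - 4) * cos (s / 2) ^+ 2 - 1)|.
Proof.
have -> : eval2 (Qk (k + 2)) (expi s) (expi t) =
  (expi s ^+ 2 + expi s + 1) * expi t ^+ 2
  + (expi s ^+ 4 + emb (k + 2) * expi s ^+ 3 + emb (2 * (k + 2) - 4) * expi s ^+ 2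
     + emb (k + 2) * expi s + 1) * expi t
  + expi s ^+ 2 * (expi s ^+ 2 + expi s + 1).
  by rewrite /eval2 /Qk /Xx /Yy /cst !hornerE.
set v := t - s.
have -> : expi t = expi v * expi s by rewrite -expiD; congr expi; rewrite /v; ring.
set A := emb (2 * cos s); set B := emb (2 * cos v).
have sA : expi s * A = expi s ^+ 2 + 1 by exact: expi_mul_cos.
have vB : expi v * B = expi v ^+ 2 + 1 by exact: expi_mul_cos.
rewrite [X in cabs X](_ : _ = expi s * expi s * expi s * expi v *
   ((A + emb 1) * B + (A * A + emb (-2) + emb (k + 2) * A + emb (2 * (k + 2) - 4)))).
  rewrite !cabsM !cabs_expi !mul1r /A /B !(embM, embD) cabs_emb.
  have -> : cos s = 2 * cos (s / 2) ^+ 2 - 1.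
    rewrite -[in LHS](_ : s / 2 *+ 2 = s); last by rewrite -mulr_natr; field.
    by rewrite cos_mulr2n -mulr_natl; ring.
  by congr `|_|; ring.
have -> : emb (-2) = - (1 + 1) by rewrite emb1 embD; congr complex.Complex; rewrite oppr0.
rewrite -emb1.
set x := expi s in sA *; set y := expi v in vB *.
move: (emb (k + 2)) (emb (2 * (k + 2) - 4)) => k1 k2.
transitivity (x ^+ 2 * (x * A + x) * (y * B) +
   x * y * ((x * A) ^+ 2 - (1 + 1) * x ^+ 2 + k1 * x * (x * A) + k2 * x ^+ 2)).
  by rewrite sA vB; ring.
by ring.
Qed.

End TorusForm.

(** * Exchange of the two integrals over the torus *)

Section MahlerJensen.
Context {R : realType}.
Local Notation mu := (@lebesgue_measure R).
Local Notation I := (`[0, (2 * pi : R)]%classic).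

Lemma integral_indicl (D : set R) (f : R -> R) :
  (\int[mu]_(x in D) (f x)%:E = \int[mu]_x (\1_D x * f x)%:E)%E.
Proof.
rewrite integral_mkcond; apply: eq_integral => x _.
by rewrite patchE indicE; case: ifP => _; rewrite ?mul1r ?mul0r.
Qed.

(** The Mahler measure integrates over [s] first, Jensen's formula over [t]. A uniform bound on the
    integrals of [|L s t|] over [t] gives integrability on the square, since [I] has finite length;
    indicators extend everything to the plane. *)
Lemma Fubini_bounded_slices (L : R -> R -> R) (v : R -> R) (K : R) :
  measurable_fun setT (fun p : R * R => L p.1 p.2) ->
  (forall s, I s -> has_integral I (L s) (v s)) ->
  (forall s w, I s -> has_integral I (fun t => `|L s t|) w -> w <= K) ->
  (\int[mu]_(t in I) \int[mu]_(s in I) (L s t)%:E = \int[mu]_(s in I) (v s)%:E)%E.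
Proof.
move=> mL Lv LK.
pose h (p : R * R) : \bar R := (\1_I p.1 * (\1_I p.2 * L p.1 p.2))%:E.
have mi : measurable_fun setT (\1_I : R -> R) by exact: measurable_indic.
have mh : measurable_fun setT h.
  apply/measurable_EFinP; apply: measurable_funM.
    by apply: measurableT_comp mi _; exact: measurable_fst.
  by apply: measurable_funM => //; apply: measurableT_comp mi _; exact: measurable_snd.
have -> : (\int[mu]_(t in I) \int[mu]_(s in I) (L s t)%:E =
   \int[mu]_t \int[mu]_s h (s, t))%E.
  rewrite integral_mkcond; apply: eq_integral => t _; rewrite patchE /h/= indicE.
  case: ifP => _.
    by rewrite integral_indicl; apply: eq_integral => s _; rewrite mul1r.
  rewrite (eq_integral (cst 0%E)) ?integral0// => s _ /=.
  by rewrite mul0r mulr0.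
have -> : (\int[mu]_(s in I) (v s)%:E = \int[mu]_s \int[mu]_t h (s, t))%E.
  rewrite integral_mkcond; apply: eq_integral => s _; rewrite patchE /h/=.
  under eq_integral do rewrite indicE.
  case: ifPn => [/set_mem sI|_].
    have [_ <-] := Lv _ sI; rewrite integral_indicl.
    by apply: eq_integral => t _; rewrite mul1r.
  by under eq_integral do rewrite mul0r; rewrite integral0.
apply/esym/Fubini.
apply/integrable12ltyP => //.
apply: (@le_lt_trans _ _ (\int[mu]_(s in I) `|K|%:E)%E); last first.
  have [_ ->] := has_integral_cst `|K| (ltW (@twopi_gt0 R)).
  exact: ltry.
rewrite [leRHS]integral_mkcond; apply: ge0_le_integral => //.
- by move=> s _; apply: integral_ge0 => t _; exact: abse_ge0.
- apply: (@measurable_fun_fubini_tonelli_F _ _ _ _ _ mu (abse \o h)) => //.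
  + by apply: measurableT_comp mh.
  + by move=> x; exact: abse_ge0.
- apply: (measurable_restrictT (fun=> `|K|%:E%E) _).1 => //.
move=> s _; rewrite patchE /h/=.
under eq_integral do rewrite indicE.
case: ifPn => [/set_mem sI|_]; last first.
  by under eq_integral do rewrite mul0r normr0; rewrite integral0.
have [Li _] := Lv _ sI.
have [w Lw] : exists w, has_integral I (fun t => `|L s t|) w.
  apply: has_integralP => //; have := integrable_abse Li.
  by apply: (@eq_integrable _ _ _ mu I).
have -> : (\int[mu]_t `|1 * (\1_I t * L s t)|%:E = w%:E)%E.
  case: Lw => _ <-; rewrite integral_indicl; apply: eq_integral => t _.
  by rewrite mul1r normrM ger0_norm// indicE.
rewrite lee_fin; apply: le_trans (LK _ _ sI Lw) (ler_norm _).
Qed.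

Lemma mahler_jensen (F : {poly {poly C R}}) (a b phi : R -> R) (M m : R) :
  (forall s t, cabs (eval2 F (expi s) (expi t)) =
     `|2 * a s * cos (t - phi s) + 2 * b s|) ->
  measurable_fun setT a -> measurable_fun setT b -> measurable_fun setT phi ->
  (forall s, I s -> 0 <= phi s <= 2 * pi) ->
  (forall s, (a s != 0) || (b s != 0)) ->
  0 <= M -> (forall s, 2 * `|a s| + 2 * `|b s| <= M) ->
  (forall s, m <= jensen (a s) (b s)) ->
  mahler F = ((((2 * pi) ^+ 2)^-1)%:E *
    \int[mu]_(s in I) (jensen (a s) (b s) * (2 * pi))%:E)%E.
Proof.
move=> FE ma mb mphi phiI ab0 M0 abM mJ.
pose L s t := ln `|2 * a s * cos (t - phi s) + 2 * b s|.
have LI s : I s -> has_integral I (L s) (jensen (a s) (b s) * (2 * pi)).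
  move=> sI; have := phiI _ sI => /andP[p0 p2].
  have := jensen_has_integral (ab0 s).
  (* The phase is removed by a translation by [2 pi - phi s], which is nonnegative. *)
  move=> /(@has_integral_shift _ (2 * pi) (2 * pi - phi s)) H.
  have {H} := H _ _ _.
  have -> : L s = fun t => ln `|2 * a s * cos (t + (2 * pi - phi s)) + 2 * b s|.
    apply/funext => t; rewrite /L; congr (ln `|_ * _ + _|).
    by rewrite (_ : _ + (_ - _) = t - phi s + 2 * pi) ?cosD2pi_mul//; ring.
  apply.
  - apply: measurableT_comp; first exact: measurable_ln.
    apply: measurableT_comp; first exact: normr_measurable.
    by apply: continuous_measurable_fun => x; exact: is_derive1_continuous.
  - by move=> x; rewrite cosD2pi_mul.
  - by apply/andP; split; lra.
have LM s t : L s t <= M.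
  rewrite /L; set x := _ + _; have [->|x0] := eqVneq x 0; first by rewrite normr0 ln0.
  have nx0 : 0 < `|x| by rewrite normr_gt0.
  apply: le_trans (ltW (ln_sublinear nx0)) (le_trans _ (abM s)).
  rewrite /x; apply: le_trans (ler_normD _ _) _.
  rewrite !normrM (ger0_norm (_ : 0 <= 2))// lerD2r -mulrA ler_pM2l//.
  by rewrite ler_piMr// ler_norml cos_geN1 cos_le1.
rewrite /mahler; congr (_ * _)%E.
have -> : (\int[mu]_(t in I) \int[mu]_(s in I) (ln (cabs (eval2 F (expi s) (expi t))))%:E
  = \int[mu]_(t in I) \int[mu]_(s in I) (L s t)%:E)%E.
  by apply: eq_integral => t _; apply: eq_integral => s _; rewrite FE.
(* From [L <= M] and [0 <= M] follows [|L| <= 2 M - L]; its integral is bounded because that of [L]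
   is at least [m * (2 pi)]. *)
apply: (@Fubini_bounded_slices _ _ (2 * M * (2 * pi - 0) - m * (2 * pi))) => //.
  apply: measurableT_comp; first exact: measurable_ln.
  apply: measurableT_comp; first exact: normr_measurable.
  have m1 (f : R -> R) : measurable_fun setT f ->
      measurable_fun setT (fun p : R * R => f p.1).
    by move=> mf; apply: measurableT_comp mf _; exact: measurable_fst.
  apply: measurable_funD; last by apply: measurable_funM => //; exact: m1.
  apply: measurable_funM.
    by apply: measurable_funM => //; exact: m1.
  apply: (@measurableT_comp _ _ _ _ _ _ (@cos R)).
    by apply: continuous_measurable_fun => x; exact: is_derive1_continuous.
  by apply: measurable_funB; [exact: measurable_snd|exact: m1].
move=> s w sI Lw.
have h1 := has_integralD (measurable_itv _)
  (has_integral_cst (2 * M) (ltW twopi_gt0)) (has_integralN (measurable_itv _) (LI _ sI)).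
apply: (@le_trans _ _ (2 * M * (2 * pi - 0) - jensen (a s) (b s) * (2 * pi))).
  apply: le_has_integral Lw h1 => // t _.
  have := LM s t; have [?|?] := ger0P (L s t); lra.
by rewrite lerD2l lerN2 ler_pM2r// twopi_gt0.
Qed.

End MahlerJensen.

(** * Elliptic integrals *)

Section DeriveHelpers.
Context {R : realType}.

Lemma is_derive_ln_comp (f : R -> R) (x d : R) : is_derive x 1 f d -> 0 < f x ->
  is_derive x 1 (fun y => ln (f y)) (d / f x).
Proof.
move=> df fx; rewrite mulrC.
exact: (@is_derive1_comp _ (@ln R) f x _ _ (is_derive1_ln fx) df).
Qed.

Lemma is_derive_sqrt_comp (f : R -> R) (x d : R) : is_derive x 1 f d -> 0 < f x ->
  is_derive x 1 (fun y => Num.sqrt (f y)) (d / (2 * Num.sqrt (f x))).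
Proof.
move=> df fx; rewrite mulrC.
exact: (@is_derive1_comp _ (@Num.sqrt R) f x _ _ (is_derive1_sqrt fx) df).
Qed.

Lemma continuous_sqrt_comp (f : R -> R) (x : R) : {for x, continuous f} ->
  {for x, continuous (fun y => Num.sqrt (f y))}.
Proof.
move=> cf; have : {for x, continuous (@Num.sqrt R \o f)} by
  apply: continuous_comp => //; exact: sqrt_continuous.
by [].
Qed.

Lemma continuous_div (f g : R -> R) (x : R) : {for x, continuous f} ->
  {for x, continuous g} -> g x != 0 -> {for x, continuous (fun y => f y / g y)}.
Proof. by move=> cf cg gx; apply: cvgM => //; exact: cvgV. Qed.

End DeriveHelpers.

(** * The Jensen value as an integral of its parameter derivative *)

Section ParameterIntegral.
Context {R : realType}.
Local Notation mu := (@lebesgue_measure R).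

Lemma jensen_le (a y : R) : - `|a| <= y <= `|a| -> jensen a y = ln `|a|.
Proof.
move=> ya; have yan : `|y| <= `|a| by rewrite ler_norml.
rewrite /jensen (max_idPl yan) ler0_sqrtr ?addr0// subr_le0.
by rewrite -(real_normK (num_real y)) -(real_normK (num_real a)) ler_pXn2r ?nnegrE.
Qed.

Lemma jensen_ge (a y : R) : `|a| <= y ->
  jensen a y = ln (y + Num.sqrt (y ^+ 2 - a ^+ 2)).
Proof.
move=> ay; have y0 : 0 <= y by exact: le_trans ay.
by rewrite /jensen (ger0_norm y0) (max_idPr ay).
Qed.

(** Above |a|, ln(y + sqrt(y^2 - a^2)) has derivative 1 / sqrt(y^2 - a^2). Between -|a| and |a| the
    Jensen value is constant, and the integrand is 0 by the conventions for square root and inverse.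
    The lower bound excludes the branch y < -|a|, where the derivative has the opposite sign;
    positivity of the maximum keeps the logarithm continuous. *)
Lemma integral_jensen_derive (a al be k K : R) : 0 < al -> k < K ->
  - `|a| <= al * k + be -> 0 < Num.max `|a| (al * k + be) ->
  (\int[mu]_(x in `]k, K[) (al / Num.sqrt ((al * x + be) ^+ 2 - a ^+ 2))%:E =
   (jensen a (al * K + be) - jensen a (al * k + be))%:E)%E.
Proof.
move=> al0 kK ak a0.
have mono x y : x < y -> al * x + be < al * y + be by move=> xy; rewrite ltrD2r ltr_pM2l.
have sq0 y : - `|a| <= y <= `|a| -> Num.sqrt (y ^+ 2 - a ^+ 2) = 0.
  rewrite -ler_norml => ya; rewrite ler0_sqrtr// subr_le0.
  by rewrite -(real_normK (num_real y)) -(real_normK (num_real a)) ler_pXn2r ?nnegrE.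
have [Ka|aK] := leP (al * K + be) `|a|.
  have kKm := mono _ _ kK.
  rewrite !jensen_le; [|apply/andP; split; lra..].
  rewrite subrr integral0_eq// => x /=; rewrite in_itv/= => /andP[kx xK].
  have h1 := mono _ _ kx; have h2 := mono _ _ xK.
  by rewrite sq0 ?invr0 ?mulr0//; apply/andP; split; lra.
(* The parameter at which [al * x + be] reaches [|a|], or [k] if that happens earlier; the integrand
   lives on []k1, K[] and may be singular at [k1]. *)
pose k1 := Num.max k ((`|a| - be) / al).
have divE : al * ((`|a| - be) / al) + be = `|a|.
  by rewrite mulrC divfK ?gt_eqF//; ring.
have yk1 : al * k1 + be = Num.max `|a| (al * k + be).
  rewrite /k1; have [h|h] := leP k ((`|a| - be) / al).
    rewrite divE (max_idPl _)//.
    by rewrite -[leRHS]divE lerD2r ler_pM2l.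
  by rewrite (max_idPr _)// -[leLHS]divE lerD2r ler_pM2l// ltW.
have kk1 : k <= k1 by rewrite /k1 le_max lexx.
have k1K : k1 < K.
  by rewrite /k1 gt_max kK/= ltr_pdivrMr// mulrC; lra.
have ak1 : `|a| <= al * k1 + be by rewrite yk1 le_max lexx.
have posx x : k1 < x -> `|a| < al * x + be.
  by move=> /mono h; exact: le_lt_trans h.
have posx2 x : k1 < x -> 0 < (al * x + be) ^+ 2 - a ^+ 2.
  move=> /posx h; rewrite subr_gt0 -(real_normK (num_real a)).
  by rewrite ltr_pXn2r ?nnegrE// ltW// (le_lt_trans _ h).
rewrite (@integral_support _ _ `]k1, K[%classic); first last.
- move=> x /=; rewrite !in_itv/= => /andP[kx xK] /negP; rewrite xK andbT -leNgt => xk1.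
  have h1 := mono _ _ kx.
  suff h2 : al * x + be <= `|a| by rewrite sq0 ?invr0 ?mulr0//; apply/andP; split; lra.
  have : al * x + be <= al * k1 + be by rewrite lerD2r ler_pM2l.
  rewrite yk1 le_max => /orP[//|h3]; lra.
- by move=> x /=; rewrite !in_itv/= => /andP[? ->]; rewrite (le_lt_trans kk1).
pose G x := ln (al * x + be + Num.sqrt ((al * x + be) ^+ 2 - a ^+ 2)).
have Gc x : k1 <= x -> {for x, continuous G}.
  move=> k1x; apply: continuous_ln_comp; last first.
    rewrite ltr_wpDr ?sqrtr_ge0//.
    have : al * k1 + be <= al * x + be by rewrite lerD2r ler_pM2l.
    by rewrite yk1; exact: lt_le_trans.
  have cl : {for x, continuous (fun x : R => al * x + be)}.
    exact: is_derive1_continuous.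
  have cq : {for x, continuous (fun x : R => Num.sqrt ((al * x + be) ^+ 2 - a ^+ 2))}.
    by apply: continuous_sqrt_comp; exact: is_derive1_continuous.
  exact: cvgD cl cq.
have -> : jensen a (al * K + be) - jensen a (al * k + be) = G K - G k1.
  congr (_ - _); first by rewrite jensen_ge// ltW// posx.
  have -> : G k1 = jensen a (al * k1 + be) by rewrite jensen_ge.
  rewrite yk1; have [h|h] := leP `|a| (al * k + be).
    by [].
  by rewrite !jensen_le ?lexx ?andbT ?ak ?ltW//=; lra.
apply: ge0_FTC_oo => //.
- by move=> x _; rewrite divr_ge0 ?sqrtr_ge0// ltW.
- move=> x /andP[k1x _]; apply: continuous_div; first exact: cvg_cst.
    apply: continuous_sqrt_comp; exact: is_derive1_continuous.
  by rewrite gt_eqF// sqrtr_gt0 posx2.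
- move=> x /andP[k1x _]; set r := Num.sqrt _.
  have r0 : 0 < r by rewrite sqrtr_gt0 posx2.
  have h0 : is_derive x 1 (fun x => (al * x + be) ^+ 2 - a ^+ 2) (2 * (al * x + be) * al).
    by apply: is_derive_eq; rewrite /GRing.scale/=; ring.
  have h1 := is_derive_sqrt_comp h0 (posx2 _ k1x).
  have h2 : is_derive x 1 (fun x => al * x + be) al.
    by apply: is_derive_eq; rewrite /GRing.scale/=; ring.
  have h3 := is_deriveD h2 h1.
  have y0 : 0 < al * x + be by apply: le_lt_trans (posx _ k1x).
  have p : 0 < al * x + be + r by rewrite addr_gt0.
  apply: (is_derive_eq (is_derive_ln_comp h3 p)).
  rewrite /= ?fctE -/r.
  field.
  by rewrite !gt_eqF.
- by apply: cvg_at_right_filter; apply: Gc.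
- by apply: cvg_at_left_filter; apply: Gc; exact: ltW.
Qed.

End ParameterIntegral.

(** * Complete elliptic integrals by an arctangent substitution *)

Section EllipticIntegral.
Context {R : realType}.
Local Notation mu := (@lebesgue_measure R).

(* Half the derivative in [s] of the elliptic integral
   [int dx / sqrt (A sin^2 x + B cos^2 x)] evaluated at
   [x = atan (la sin (s / 2) / sqrt (cos (s / 2) ^+ 2 - r ^+ 2))]; it vanishes where
   [cos (s / 2) ^+ 2 <= r ^+ 2]. *)
Definition elliptic_density (A B la r s : R) :=
  la * cos (s / 2) * (1 - r ^+ 2) /
  (4 * Num.sqrt (cos (s / 2) ^+ 2 - r ^+ 2) *
   Num.sqrt ((cos (s / 2) ^+ 2 - r ^+ 2 + la ^+ 2 * sin (s / 2) ^+ 2) *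
     (A * la ^+ 2 * sin (s / 2) ^+ 2 + B * (cos (s / 2) ^+ 2 - r ^+ 2)))).

(** The interval contains [[- pi / 2, pi / 2]] in its interior, so the primitive is continuous at
    the limits of the arctangent. *)
Lemma elliptic_antiderivative (A B : R) : 0 < A -> 0 < B ->
  exists F : R -> R, forall x : R, -2 < x < 2 ->
    is_derive x 1 F (Num.sqrt (A * sin x ^+ 2 + B * cos x ^+ 2))^-1.
Proof.
move=> A0 B0; pose G (x : R) := (Num.sqrt (A * sin x ^+ 2 + B * cos x ^+ 2))^-1.
have pos x : 0 < A * sin x ^+ 2 + B * cos x ^+ 2.
  have [s0|s0] := eqVneq (sin x) 0.
    have := cos2Dsin2 x; rewrite s0 expr0n/= addr0 => ->; lra.
  apply: ltr_pwDl; first by rewrite mulr_gt0// exprn_even_gt0.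
  by rewrite mulr_ge0 ?sqr_ge0// ltW.
have cG x : {for x, continuous G}.
  apply: continuousV; first by rewrite gt_eqF// sqrtr_gt0.
  by apply: continuous_sqrt_comp; exact: is_derive1_continuous.
have [v [Gi _]] := continuous_has_integral (-2) 2 cG.
exists (fun x => \int[mu]_(t in [set` `[-2, x]]) (G t)) => x /andP[x1 x2].
have [dF F'] := @continuous_FTC1_closed R G (-2) x 2 x2 Gi x1 (cG x).
by apply: DeriveDef => //; rewrite -derive1E.
Qed.

(** The point is that [c] is chosen before [la] and [r]: the substitution maps the support of the
    density onto []- pi / 2, pi / 2[] whatever they are. *)
Lemma elliptic_density_integral (A B : R) : 0 < A -> 0 < B ->
  exists c : R, forall la r : R, 0 < la -> 0 < r < 1 ->
  (\int[mu]_(s in `](- pi)%R, (pi : R)%R[) (elliptic_density A B la r s)%:E = c%:E)%E.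
Proof.
move=> A0 B0; have [F dF] := elliptic_antiderivative A0 B0.
exists (2^-1 * F (pi / 2) - 2^-1 * F (- (pi / 2))) => la r la0 /andP[r0 r1].
have pi0 := pi_gt0 R.
have r11 : -1 <= r <= 1 by apply/andP; split; lra.
(* At [s0] the cosine of [s / 2] falls to [r]; farther out the radicand is nonpositive and the
   density is 0. *)
pose s0 := 2 * acos r.
have s0gt : 0 < s0 by rewrite mulr_gt0// acos_gt0//; apply/andP; split; lra.
have cs0 : cos (s0 / 2) = r.
  by rewrite /s0 mulrC mulKf// acosK// in_itv.
have s0pi : s0 < pi.
  rewrite ltNge; apply/negP => h.
  have : acos r <= pi by exact: acos_lepi.
  move=> h2; have : cos (s0 / 2) <= cos (pi / 2).
    rewrite leNgt ltr_cos ?in_itv/= -?leNgt; [lra|apply/andP; split; rewrite /s0 in h *; lra..].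
  by rewrite cs0 cos_pihalf; lra.
have cosin (s : R) : - s0 < s < s0 -> r < cos (s / 2).
  move=> /andP[s1 s2]; rewrite -cs0.
  have [sp|sn] := leP 0 s.
    by rewrite ltr_cos ?in_itv/=; [lra|apply/andP; split; lra..].
  rewrite -[ltRHS]cosN ltr_cos ?in_itv/=; [lra|apply/andP; split; lra..].
have cosout (s : R) : - pi < s < pi -> ~ (- s0 < s < s0) -> cos (s / 2) ^+ 2 <= r ^+ 2.
  move=> /andP[s1 s2] sout.
  have c0 : 0 <= cos (s / 2) by apply: cos_ge0_pihalf; apply/andP; split; lra.
  rewrite ler_pXn2r ?nnegrE; [|by []|by []|exact: ltW].
  rewrite -cs0; have [sp|sn] := leP 0 s.
    have ss : s0 <= s by rewrite leNgt; apply/negP => h; apply: sout; apply/andP; split; lra.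
    by rewrite leNgt ltr_cos ?in_itv/= -?leNgt; [lra|apply/andP; split; lra..].
  have ss : s <= - s0 by rewrite leNgt; apply/negP => h; apply: sout; apply/andP; split; lra.
  rewrite -[X in X <= _]cosN leNgt ltr_cos ?in_itv/= -?leNgt; [lra|apply/andP; split; lra..].
rewrite (@integral_support _ _ `](- s0), s0[%classic); first last.
- move=> s /=; rewrite !in_itv/= => sp sout.
  rewrite /elliptic_density (ler0_sqrtr (_ : cos (s / 2) ^+ 2 - r ^+ 2 <= 0)).
    by rewrite mulr0 mul0r invr0 mulr0.
  by rewrite subr_le0 cosout.
- by move=> s /=; rewrite !in_itv/= => /andP[? ?]; apply/andP; split; lra.
pose w (s : R) := Num.sqrt (cos (s / 2) ^+ 2 - r ^+ 2).
pose u (s : R) := la * sin (s / 2) / w s.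
have Cpos (s : R) : - s0 < s < s0 -> 0 < cos (s / 2) ^+ 2 - r ^+ 2.
  move=> /cosin h; rewrite subr_gt0 ltr_pXn2r ?nnegrE// ltW//; lra.
have sinc2 (s : R) : sin (s / 2) ^+ 2 = 1 - cos (s / 2) ^+ 2 :> R.
  by have := cos2Dsin2 (s / 2); lra.
have X0 (s : R) : - s0 < s < s0 -> 0 < cos (s / 2) ^+ 2 - r ^+ 2 + la ^+ 2 * sin (s / 2) ^+ 2.
  by move=> /Cpos h; rewrite ltr_pwDl// mulr_ge0 ?sqr_ge0.
have Y0 (s : R) : - s0 < s < s0 ->
    0 < A * la ^+ 2 * sin (s / 2) ^+ 2 + B * (cos (s / 2) ^+ 2 - r ^+ 2).
  move=> /Cpos h; apply: ltr_wpDl; last exact: mulr_gt0.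
  by rewrite mulr_ge0 ?sqr_ge0// mulr_ge0 ?sqr_ge0// ltW.
have cC : forall s : R, {for s, continuous (fun s : R => cos (s / 2) ^+ 2 - r ^+ 2)}.
  by move=> x; exact: is_derive1_continuous.
have cw : forall s : R, {for s, continuous w}.
  by move=> x; exact: continuous_sqrt_comp (cC x).
have atan2 (x : R) : -2 < atan x < 2.
  have := atan_gtNpi2 x; have := atan_ltpi2 x; have := @pihalf_lt2 R => ? ? ?.
  by apply/andP; split; lra.
have lim_u : u s @[s --> s0^'-] --> +oo.
  have snear : \forall x \near s0^'-, 0 < x < s0.
    near=> x; apply/andP; split; near: x; [exact: nbhs_left_gt|exact: nbhs_left_lt].
  have sinpos (x : R) : 0 < x < s0 -> 0 < sin (x / 2).
    by move=> /andP[? ?]; apply: sin_gt0_pi; apply/andP; split; lra.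
  apply/gtr0_cvgV0.
    near=> x; have sb : 0 < x < s0 by near: x.
    rewrite /u divr_gt0 ?mulr_gt0 ?sinpos// sqrtr_gt0 Cpos//.
    by move/andP : sb => [? ?]; apply/andP; split; lra.
  rewrite [X in X @ _ --> _](_ : _ = fun x : R => w x / (la * sin (x / 2))); last first.
    by apply/funext => x; rewrite /u /= invf_div.
  rewrite (_ : 0 = w s0 / (la * sin (s0 / 2))); last first.
    by rewrite /w cs0 subrr sqrtr0 mul0r.
  apply: cvg_at_left_filter; apply: continuous_div.
  - exact: cw.
  - exact: is_derive1_continuous.
  - rewrite gt_eqF// mulr_gt0// sin_gt0_pi//; apply/andP; split; lra.
have Fc (x : R) : - 2 < x < 2 -> {for x, continuous F}.
  by move=> /dF; exact: is_derive1_continuous.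
have lim_at : atan (u s) @[s --> s0^'-] --> pi / 2 by exact: (cvg_comp u (@atan R) lim_u (@cvgy_atan R)).
have pi2 : -2 < (pi / 2 : R) < 2.
  by have := @pihalf_lt2 R => ?; apply/andP; split; lra.
have := @ge0_FTC_oo R (elliptic_density A B la r) (fun s : R => 2^-1 * F (atan (u s)))
  (- s0) s0 (2^-1 * F (- (pi / 2))) (2^-1 * F (pi / 2)).
apply.
- lra.
- move=> s sb; have h := cosin _ sb; apply: divr_ge0.
    have r2 : 0 <= 1 - r ^+ 2 by rewrite subr_ge0 expr_le1// ltW.
    apply: mulr_ge0 => //; apply: mulr_ge0; lra.
  apply: mulr_ge0; last exact: sqrtr_ge0.
  by apply: mulr_ge0 => //; exact: sqrtr_ge0.
- move=> s sb; apply: continuous_div.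
  + exact: is_derive1_continuous.
  + have cXY : {for s, continuous (fun s : R => Num.sqrt
        ((cos (s / 2) ^+ 2 - r ^+ 2 + la ^+ 2 * sin (s / 2) ^+ 2) *
         (A * la ^+ 2 * sin (s / 2) ^+ 2 + B * (cos (s / 2) ^+ 2 - r ^+ 2))))}.
      by apply: continuous_sqrt_comp; exact: is_derive1_continuous.
    exact: (cvgM (cvgMl_tmp (cw s)) cXY).
  + by rewrite gt_eqF// !mulr_gt0 ?sqrtr_gt0 ?mulr_gt0 ?Cpos ?X0 ?Y0.
- move=> s sb.
  have w0 : 0 < w s by rewrite sqrtr_gt0 Cpos.
  have w2 : w s ^+ 2 = cos (s / 2) ^+ 2 - r ^+ 2 by rewrite sqr_sqrtr// ltW// Cpos.
  have h0 : is_derive s 1 (fun s : R => cos (s / 2) ^+ 2 - r ^+ 2)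
      (- (cos (s / 2) * sin (s / 2))).
    by apply: is_derive_eq; rewrite /GRing.scale/=; field.
  have h1 : is_derive s 1 w _ := is_derive_sqrt_comp h0 (Cpos _ sb).
  have wn0 : w s != 0 by rewrite gt_eqF.
  have h2 := is_deriveV wn0 h1.
  have h3 : is_derive s 1 (fun s : R => la * sin (s / 2)) (la * (cos (s / 2) / 2)).
    by apply: is_derive_eq; rewrite /GRing.scale/=; field.
  have h4 : is_derive s 1 u _ := is_deriveM h3 h2.
  have h5 := @is_derive1_comp _ (@atan R) u s _ _ (is_derive1_atan _) h4.
  have h6 := @is_derive1_comp _ F (@atan R \o u) s _ _ (dF _ (atan2 _)) h5.
  have h7 := is_deriveZ 2^-1 h6.
  apply: (is_derive_eq h7).
  rewrite /GRing.scale/= -/(w s) /elliptic_density -/(w s).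
  set c := cos (s / 2) in w2 *; set S := sin (s / 2).
  (* [S ^+ 2 + w s ^+ 2] is the factor produced by differentiating the quotient of [S] by [w]. *)
  have E1 : 1 - r ^+ 2 = S ^+ 2 + w s ^+ 2 by rewrite w2 sinc2 -/c; ring.
  have := X0 _ sb; have := Y0 _ sb; rewrite -/c -/S -w2.
  set Y := (X in 0 < X -> _) => Yp; set X := (X in 0 < X -> _) => Xp.
  have U1 : 1 + u s ^+ 2 = X / w s ^+ 2.
    by rewrite /u /X -/S; field.
  have U1n : 1 + u s ^+ 2 != 0 by rewrite U1 gt_eqF// divr_gt0// exprn_gt0.
  have c2 : cos (atan (u s)) ^+ 2 = (1 + u s ^+ 2)^-1.
    by rewrite cos_atan exprVn sqr_sqrtr// addr_ge0 ?sqr_ge0.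
  have s2 : sin (atan (u s)) ^+ 2 = u s ^+ 2 / (1 + u s ^+ 2).
    have := cos2Dsin2 (atan (u s)); rewrite c2 => /(canRL (addKr _)) ->.
    by field.
  have YX : A * sin (atan (u s)) ^+ 2 + B * cos (atan (u s)) ^+ 2 = Y / X.
    rewrite c2 s2 U1 /u /Y -/S; field.
    by rewrite wn0 gt_eqF.
  have Zp : 0 < Num.sqrt (Y / X) by rewrite sqrtr_gt0 divr_gt0.
  have XY : Num.sqrt (X * Y) = X * Num.sqrt (Y / X).
    rewrite -[X in X * Num.sqrt _](ger0_norm (ltW Xp)) -sqrtr_sqr -sqrtrM ?sqr_ge0//.
    by congr Num.sqrt; field; rewrite gt_eqF.
  rewrite YX XY U1 E1; field.
  by rewrite wn0 !gt_eqF.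
(* [u] is odd, so the limit at [- s0] reduces to the one at [s0]. *)
- apply/cvg_at_rightNP; rewrite opprK.
  rewrite [X in X @ _ --> _](_ : _ = fun x : R => 2^-1 * F (- atan (u x))); last first.
    apply/funext => x /=; congr (_ * F _); rewrite -atanN; congr atan.
    by rewrite /u /w mulNr sinN cosN mulrN mulNr.
  apply: cvgMl_tmp.
  apply: continuous_cvg; last exact: cvgN.
  by apply: Fc; move/andP: pi2 => [? ?]; apply/andP; split; lra.
- apply: cvgMl_tmp; apply: continuous_cvg => //; exact: Fc.
Unshelve. all: by end_near. Qed.

End EllipticIntegral.

(** * Factorization of the radicands and equality of the increments *)

Section EllipticFactorizations.
Context {R : realType}.
Local Notation mu := (@lebesgue_measure R).

Definition acoef (s : R) := 4 * cos (s / 2) ^+ 2 - 1.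
Definition bP (k s : R) := k * cos (s / 2).
Definition bQ (k s : R) := 8 * cos (s / 2) ^+ 4 + (2 * k - 4) * cos (s / 2) ^+ 2 - 1.
(* The derivatives of [jensen (acoef s) (bP k s)] and [jensen (acoef s) (bQ k s)] in
   [k]; where [|b| < |acoef s|] they are 0, as [Num.sqrt] and the inverse then are. *)
Definition dP (k s : R) := cos (s / 2) / Num.sqrt (bP k s ^+ 2 - acoef s ^+ 2).
Definition dQ (k s : R) :=
  2 * cos (s / 2) ^+ 2 / Num.sqrt (bQ k s ^+ 2 - acoef s ^+ 2).

Lemma cos_half_gt0 (s : R) : - pi < s < pi -> 0 < cos (s / 2).
Proof. by move=> /andP[? ?]; apply: cos_gt0_pihalf; apply/andP; split; lra. Qed.

(* [p] and [- q] are the roots of [4 x ^+ 2 + k * x - 1]. *)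
Lemma roots_exist (k : R) : 4 <= k -> exists p q : R,
  [/\ 0 < p < 1, 1 < q, p * q = 4^-1, q - p = k / 4 & 1 <= q - p].
Proof.
move=> k4; pose r := Num.sqrt (k ^+ 2 + 16).
have r2 : r ^+ 2 = k ^+ 2 + 16 by rewrite sqr_sqrtr// addr_ge0 ?sqr_ge0.
have rk : k < r.
  by rewrite -ltr_sqr ?nnegrE ?sqrtr_ge0//; [rewrite r2; lra|lra].
have rk8 : r < k + 8.
  by rewrite -ltr_sqr ?nnegrE ?sqrtr_ge0//; [rewrite r2; nra|lra].
exists ((r - k) / 8), ((r + k) / 8); split; try lra.
Qed.

Lemma sqrtM2 (x y : R) : 0 <= x -> Num.sqrt (x ^+ 2 * y) = x * Num.sqrt y.
Proof. by move=> x0; rewrite sqrtrM ?sqr_ge0// sqrtr_sqr ger0_norm. Qed.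

(** The factors b_P - a and b_P + a are 4 (q - c) (c + p) and 4 (c - p) (c + q). For [la = 1] and
    [r = p] the first factor under the second root is the constant 1 - p^2, and the values of [A]
    and [B] make the other one (1 - p^2) (q^2 - c^2). *)
Lemma dP_elliptic (k p q s : R) : 0 < p -> p < 1 -> 1 < q -> p * q = 4^-1 ->
  q - p = k / 4 -> - pi < s < pi ->
  dP k s = elliptic_density (q ^+ 2 - p ^+ 2) (q ^+ 2 - 1) 1 p s.
Proof.
move=> p0 p1 q1 pq qpk /cos_half_gt0; rewrite /dP /bP /acoef /elliptic_density.
have := cos2Dsin2 (s / 2); have := cos_le1 (s / 2).
move: (cos _) (sin _) => c S c1 /(canRL (addKr _)) -> c0.
have -> : k = 4 * (q - p) by rewrite qpk; field.
have -> : (4 * (q - p) * c) ^+ 2 - (4 * c ^+ 2 - 1) ^+ 2 =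
    4 ^+ 2 * ((q ^+ 2 - c ^+ 2) * (c ^+ 2 - p ^+ 2)).
  have -> : 4 * c ^+ 2 - 1 = 4 * c ^+ 2 - 4 * (p * q) by rewrite pq; field.
  by ring.
have p20 : 0 < 1 - p ^+ 2 by rewrite subr_gt0 expr_lt1// ltW.
have qc : 0 < q ^+ 2 - c ^+ 2.
  by rewrite subr_gt0 ltr_pXn2r ?nnegrE//; lra.
have -> : (c ^+ 2 - p ^+ 2 + 1 ^+ 2 * (- c ^+ 2 + 1)) *
    ((q ^+ 2 - p ^+ 2) * 1 ^+ 2 * (- c ^+ 2 + 1) + (q ^+ 2 - 1) * (c ^+ 2 - p ^+ 2)) =
    (1 - p ^+ 2) ^+ 2 * (q ^+ 2 - c ^+ 2) by ring.
rewrite !sqrtM2 ?ltW// sqrtrM ?ltW// mul1r.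
have z0 : 0 < Num.sqrt (q ^+ 2 - c ^+ 2) by rewrite sqrtr_gt0.
(* This covers every [c <= p]: both sides are 0, the inverse of 0 being 0. *)
have [->|w0] := eqVneq (Num.sqrt (c ^+ 2 - p ^+ 2)) 0.
  by rewrite !(mulr0, mul0r) !invr0 !mulr0.
by field; rewrite w0 !gt_eqF.
Qed.

(** Here b_Q + a = 8 (c^2 + q) (c^2 - p) and b_Q - a = 8 c^2 (c^2 - 1 + q - p). The choice of [la]
    makes the two factors under the second root proportional to c^2 - 1 + q - p and c^2 + q; the
    bound on [q - p] gives the first of these a sign. *)
Lemma dQ_elliptic (k p q s : R) : 0 < p -> p < 1 -> 1 < q -> p * q = 4^-1 ->
  q - p = k / 4 -> 1 <= q - p -> - pi < s < pi ->
  dQ k s = elliptic_density (q ^+ 2 - p ^+ 2) (q ^+ 2 - 1)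
    (Num.sqrt ((q - 1) / (q - p))) (Num.sqrt p) s.
Proof.
move=> p0 p1 q1 pq qpk qp1 /cos_half_gt0; rewrite /dQ /bQ /acoef /elliptic_density.
have := cos2Dsin2 (s / 2); have := cos_le1 (s / 2).
move: (cos _) (sin _) => c S c1 /(canRL (addKr _)) -> c0.
have -> : k = 4 * (q - p) by rewrite qpk; field.
have qp0 : 0 < q - p by lra.
have la0 : 0 < (q - 1) / (q - p) by rewrite divr_gt0//; lra.
set la := Num.sqrt ((q - 1) / (q - p)).
have lap : 0 < la by rewrite sqrtr_gt0.
have la2 : la ^+ 2 = (q - 1) / (q - p) by rewrite sqr_sqrtr// ltW.
rewrite (sqr_sqrtr (ltW p0)).
have ce : 0 < c ^+ 2 - 1 + q - p.
  have : 0 < c ^+ 2 by rewrite exprn_gt0.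
  lra.
have cq : 0 < c ^+ 2 + q by rewrite ltr_wpDl ?sqr_ge0//; lra.
have -> : (8 * c ^+ 4 + (2 * (4 * (q - p)) - 4) * c ^+ 2 - 1) ^+ 2 -
    (4 * c ^+ 2 - 1) ^+ 2 =
    (8 * c) ^+ 2 * ((c ^+ 2 - 1 + q - p) * (c ^+ 2 + q) * (c ^+ 2 - p)).
  have e : 8 * c ^+ 4 + (2 * (4 * (q - p)) - 4) * c ^+ 2 - 1 + (4 * c ^+ 2 - 1) =
      8 * ((c ^+ 2 + q) * (c ^+ 2 - p)).
    have -> : 8 * ((c ^+ 2 + q) * (c ^+ 2 - p)) =
      8 * c ^+ 4 + 8 * (q - p) * c ^+ 2 - 8 * (p * q) by ring.
    by rewrite pq; field.
  by rewrite subr_sqr e; ring.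
have -> : (c ^+ 2 - p + la ^+ 2 * (- c ^+ 2 + 1)) *
    ((q ^+ 2 - p ^+ 2) * la ^+ 2 * (- c ^+ 2 + 1) + (q ^+ 2 - 1) * (c ^+ 2 - p)) =
    ((1 - p) * la) ^+ 2 * ((c ^+ 2 - 1 + q - p) * (c ^+ 2 + q)).
  rewrite exprMn la2; field; lra.
have p10 : 0 < 1 - p by lra.
rewrite !sqrtM2 ?mulr_ge0 ?ltW//.
rewrite [Num.sqrt (_ * (c ^+ 2 - p))]sqrtrM ?mulr_ge0 ?ltW//.
have z0 : 0 < Num.sqrt ((c ^+ 2 - 1 + q - p) * (c ^+ 2 + q)).
  by rewrite sqrtr_gt0 mulr_gt0.
have [->|w0] := eqVneq (Num.sqrt (c ^+ 2 - p)) 0.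
  by rewrite !(mulr0, mul0r) !invr0 !mulr0.
by field; rewrite w0 !gt_eqF.
Qed.

Lemma integral_dP_dQ (k : R) : 4 <= k ->
  (\int[mu]_(s in `](- pi)%R, (pi : R)%R[) (dP k s)%:E =
   \int[mu]_(s in `](- pi)%R, (pi : R)%R[) (dQ k s)%:E)%E.
Proof.
move=> /roots_exist[p [q [/andP[p0 p1] q1 pq qpk qp1]]].
have A0 : 0 < q ^+ 2 - p ^+ 2 by rewrite subr_gt0 ltr_pXn2r ?nnegrE//; lra.
have B0 : 0 < q ^+ 2 - 1 by rewrite subr_gt0 -[ltLHS](expr1n _ 2) ltr_pXn2r ?nnegrE//; lra.
have [c H] := elliptic_density_integral A0 B0.
transitivity (c%:E).
  rewrite -(H 1 p)//; last by rewrite p0.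
  apply: eq_integral => s; rewrite inE/= in_itv/= => sp.
  by rewrite (dP_elliptic p0 p1 q1 pq qpk sp).
rewrite -(H (Num.sqrt ((q - 1) / (q - p))) (Num.sqrt p))//.
- apply: eq_integral => s; rewrite inE/= in_itv/= => sp.
  by rewrite (dQ_elliptic p0 p1 q1 pq qpk qp1 sp).
- by rewrite sqrtr_gt0 divr_gt0//; lra.
- by rewrite sqrtr_gt0 p0 -[ltRHS]sqrtr1 ltr_sqrt.
Qed.

(** The inverse is discontinuous at 0, where it is 0; on nonnegative reals it is the power with
    exponent -1, which is measurable. *)
Lemma measurable_inv_sqrt (d : measure_display) (T : measurableType d) (f : T -> R) :
  measurable_fun setT f -> measurable_fun setT (fun x => (Num.sqrt (f x))^-1).
Proof.
move=> mf.
have -> : (fun x => (Num.sqrt (f x))^-1) = (fun x => Num.sqrt (f x) `^ (-1)).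
  by apply/funext => x; rewrite powR_inv1// sqrtr_ge0.
apply: (@measurableT_comp _ _ _ _ _ _ (fun x : R => x `^ (-1))).
  exact: measurable_powR.
apply: measurableT_comp mf.
by apply: continuous_measurable_fun; exact: sqrt_continuous.
Qed.

Lemma Tonelli_slices (D E : set R) (f : R -> R -> R) : measurable D -> measurable E ->
  measurable_fun setT (fun p : R * R => f p.1 p.2) ->
  (forall x y, D x -> E y -> 0 <= f x y) ->
  (\int[mu]_(x in D) \int[mu]_(y in E) (f x y)%:E =
   \int[mu]_(y in E) \int[mu]_(x in D) (f x y)%:E)%E.
Proof.
move=> mD mE mf f0.
pose h (p : R * R) : \bar R := (\1_D p.1 * (\1_E p.2 * f p.1 p.2))%:E.
have mD' : measurable_fun setT (\1_D : R -> R) by exact: measurable_indic.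
have mE' : measurable_fun setT (\1_E : R -> R) by exact: measurable_indic.
have mh : measurable_fun setT h.
  apply/measurable_EFinP; apply: measurable_funM.
    by apply: measurableT_comp mD' _; exact: measurable_fst.
  apply: measurable_funM => //.
  by apply: measurableT_comp mE' _; exact: measurable_snd.
have h0 p : (0 <= h p)%E.
  rewrite /h lee_fin !indicE; case: (boolP (p.1 \in D)) => [/set_mem Dp|_]; last by rewrite mul0r.
  by case: (boolP (p.2 \in E)) => [/set_mem Ep|_]; rewrite ?mul0r ?mulr0// !mul1r f0.
transitivity (\int[mu]_x \int[mu]_y h (x, y))%E.
  rewrite integral_mkcond; apply: eq_integral => x _; rewrite patchE /h/=.
  under [RHS]eq_integral do rewrite indicE.
  case: ifPn => [_|_].
    by rewrite integral_indicl; apply: eq_integral => t _; rewrite mul1r.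
  by under eq_integral do rewrite mul0r; rewrite integral0.
transitivity (\int[mu]_y \int[mu]_x h (x, y))%E; first exact: fubini_tonelli.
rewrite [RHS]integral_mkcond.
apply: eq_integral => y _; rewrite patchE /h/= indicE.
case: ifPn => [_|_].
  by rewrite [RHS]integral_indicl; apply: eq_integral => t _; rewrite mul1r.
by under eq_integral do rewrite mul0r mulr0; rewrite integral0.
Qed.

Lemma measurable_cos_half : measurable_fun setT (fun s : R => cos (s / 2)).
Proof. by apply: continuous_measurable_fun => s; exact: is_derive1_continuous. Qed.

Lemma integral_jensen_increment (b d : R -> R -> R) (al be : R -> R) (k K : R) :
  k < K ->
  measurable_fun setT (fun p : R * R => d p.2 p.1) ->
  (forall s, - pi < s < pi -> forall x, b x s = al s * x + be s) ->
  (forall s, - pi < s < pi -> forall x,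
     d x s = al s / Num.sqrt (b x s ^+ 2 - acoef s ^+ 2)) ->
  (forall s, - pi < s < pi -> 0 < al s) ->
  (forall s, - pi < s < pi ->
     - `|acoef s| <= b k s /\ 0 < Num.max `|acoef s| (b k s)) ->
  (\int[mu]_(s in `](- pi)%R, (pi : R)%R[)
     (jensen (acoef s) (b K s) - jensen (acoef s) (b k s))%:E =
   \int[mu]_(x in `]k, K[) \int[mu]_(s in `](- pi)%R, (pi : R)%R[) (d x s)%:E)%E.
Proof.
move=> kK md bE dE al0 bk.
rewrite -(@Tonelli_slices _ _ (fun s x => d x s))//; last first.
  move=> s x /=; rewrite in_itv/= => sp _; rewrite dE// divr_ge0 ?sqrtr_ge0//.
  exact/ltW/al0.
apply: eq_integral => s; rewrite inE/= in_itv/= => sp.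
have [h1 h2] := bk _ sp; rewrite !bE// in h1 h2 *.
rewrite -(integral_jensen_derive (al0 _ sp) kK h1 h2).
by apply: eq_integral => x _; rewrite dE// bE.
Qed.

Lemma integral_jensen_increment_PQ (k K : R) : 4 <= k -> k < K ->
  (\int[mu]_(s in `](- pi)%R, (pi : R)%R[)
     (jensen (acoef s) (bP K s) - jensen (acoef s) (bP k s))%:E =
   \int[mu]_(s in `](- pi)%R, (pi : R)%R[)
     (jensen (acoef s) (bQ K s) - jensen (acoef s) (bQ k s))%:E)%E.
Proof.
move=> k4 kK.
have mc : measurable_fun setT (fun p : R * R => cos (p.1 / 2)).
  by apply: (measurableT_comp measurable_cos_half); exact: measurable_fst.
have mcX n : measurable_fun setT (fun p : R * R => cos (p.1 / 2) ^+ n).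
  exact: measurable_funX.
have ma : measurable_fun setT (fun p : R * R => acoef p.1).
  by apply: measurable_funB => //; apply: measurable_funM.
have m2 : measurable_fun setT (fun p : R * R => p.2) by exact: measurable_snd.
have incP : (\int[mu]_(s in `](- pi)%R, (pi : R)%R[)
     (jensen (acoef s) (bP K s) - jensen (acoef s) (bP k s))%:E =
   \int[mu]_(x in `]k, K[) \int[mu]_(s in `](- pi)%R, (pi : R)%R[) (dP x s)%:E)%E.
  apply: (@integral_jensen_increment bP dP (fun s => cos (s / 2)) (fun=> 0)) => //; first last.
  - move=> s /cos_half_gt0 c0; rewrite /bP.
    have kc : 0 < k * cos (s / 2) by rewrite mulr_gt0//; lra.
    split; last by rewrite lt_max kc orbT.
    by apply: le_trans (ltW kc); rewrite oppr_le0.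
  - by move=> s; exact: cos_half_gt0.
  - by move=> s _ x; rewrite /bP mulrC addr0.
  - apply: measurable_funM => //; apply: measurable_inv_sqrt.
    apply: measurable_funB; apply: measurable_funX => //.
    exact: measurable_funM.
have incQ : (\int[mu]_(s in `](- pi)%R, (pi : R)%R[)
     (jensen (acoef s) (bQ K s) - jensen (acoef s) (bQ k s))%:E =
   \int[mu]_(x in `]k, K[) \int[mu]_(s in `](- pi)%R, (pi : R)%R[) (dQ x s)%:E)%E.
  apply: (@integral_jensen_increment bQ dQ (fun s => 2 * cos (s / 2) ^+ 2)
    (fun s => 8 * cos (s / 2) ^+ 4 - 4 * cos (s / 2) ^+ 2 - 1)) => //; first last.
  - move=> s /cos_half_gt0; rewrite /bQ /acoef.
    move: (cos _) => c c0.
    have t0 : 0 < c ^+ 2 by rewrite exprn_gt0.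
    have -> : c ^+ 4 = (c ^+ 2) ^+ 2 by rewrite -exprM.
    (* With [t] for [c ^+ 2], b_Q - a = 8 t^2 + (2 k - 8) t is nonnegative as k >= 4, hence b_Q >= a
       >= -|a|. *)
    move: (c ^+ 2) t0 => t t0; split.
      rewrite lerNl; apply: (@le_trans _ _ (- (4 * t - 1))); last first.
        by rewrite -normrN ler_norm.
      by nra.
    (* If b_Q <= 0 then a cannot vanish: a = 0 means t = 1/4, where b_Q = (k - 3) / 2. *)
    rewrite lt_max; have [h|h] := ltP 0 (8 * t ^+ 2 + (2 * k - 4) * t - 1).
      by rewrite orbT.
    rewrite orbF normr_gt0; apply: contraTneq h => h; rewrite -ltNge.
    have -> : t = 4^-1 by lra.
    lra.
  - by move=> s /cos_half_gt0 c0; rewrite mulr_gt0// exprn_gt0.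
  - by move=> s _ x; rewrite /bQ; ring.
  - apply: measurable_funM; first exact: measurable_funM.
    apply: measurable_inv_sqrt.
    apply: measurable_funB; apply: measurable_funX => //.
    apply: measurable_funB => //; apply: measurable_funD.
      by apply: measurable_funM => //; exact: mcX.
    apply: measurable_funM; last exact: mcX.
    by apply: measurable_funB => //; exact: measurable_funM.
apply: (etrans incP); apply: (etrans _ (esym incQ)).
apply: eq_integral => x; rewrite inE/= in_itv/= => /andP[kx _].
by rewrite integral_dP_dQ//; lra.
Qed.

End EllipticFactorizations.

(** * The limit for large parameters *)

Section Conclusion.
Context {R : realType}.
Local Notation mu := (@lebesgue_measure R).
Local Notation I := (`[0, (2 * pi : R)]%classic).
Local Notation D := (`](- pi)%R, (pi : R)%R[%classic).

(** The open centered period is the one on which [cos (s / 2)] is positive. *)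
Lemma integral_periodic_centered (f : R -> \bar R) : measurable_fun setT f ->
  (forall x, f (x + 2 * pi) = f x) ->
  (\int[mu]_(x in I) f x = \int[mu]_(x in D) f x)%E.
Proof.
move=> mf pf; have pi0 := pi_gt0 R.
rewrite -(@integral_periodic _ (2 * pi) pi)//; last by apply/andP; split; lra.
have -> : (\int[mu]_(x in D) f x = \int[mu]_(x in `[(- pi)%R, (pi : R)%R]) f x)%E.
  by rewrite [RHS]integral_itv_bndoo//; exact: measurable_funTS.
rewrite -(@integral_shift _ (- pi) `[(- pi)%R, (pi : R)%R]%classic f)//; last first.
  exact: measurable_funTS.
rewrite (_ : [set x | _] = I).
  by apply: eq_integral => x _; rewrite -[in RHS]pf; congr f; ring.
by apply/seteqP; split => x /=; rewrite !in_itv/= => /andP[? ?];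
  apply/andP; split; lra.
Qed.

Lemma has_integral_centered (f : R -> R) (v : R) : measurable_fun setT f ->
  (forall x, f (x + 2 * pi) = f x) -> has_integral I f v -> has_integral D f v.
Proof.
move=> mf pf [fi fv]; split; last first.
  rewrite -fv -integral_periodic_centered//; first exact/measurable_EFinP.
  by move=> x; rewrite pf.
apply/integrableP; split; first by apply/measurable_EFinP; exact: measurable_funTS.
rewrite /= -(integral_periodic_centered (f := fun x => `|(f x)%:E|%E)).
- by move/integrableP : fi => [].
- by apply: measurableT_comp => //; exact/measurable_EFinP.
- by move=> x; rewrite pf.
Qed.

Lemma measurable_jensen (a b : R -> R) : measurable_fun setT a ->
  measurable_fun setT b -> measurable_fun setT (fun s => jensen (a s) (b s)).
Proof.
move=> ma mb; apply: measurableT_comp; first exact: measurable_ln.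
apply: measurable_funD.
  by apply: measurable_maxr; apply: measurableT_comp => //; exact: normr_measurable.
apply: (measurableT_comp (continuous_measurable_fun (@sqrt_continuous R))).
by apply: measurable_funB; exact: measurable_funX.
Qed.

Lemma jensen_bounds (a b m M : R) : 0 < m -> m <= Num.max `|a| `|b| ->
  Num.max `|a| `|b| <= M -> ln m <= jensen a b <= ln (2 * M).
Proof.
move=> m0 mm MM; rewrite /jensen; set x := Num.max _ _ in mm MM *.
have x0 : 0 < x by exact: lt_le_trans mm.
have s0 := sqrtr_ge0 (b ^+ 2 - a ^+ 2).
have sx : Num.sqrt (b ^+ 2 - a ^+ 2) <= x.
  apply: (@le_trans _ _ `|b|); last by rewrite /x le_max lexx orbT.
  by rewrite -(sqrtr_sqr b) ler_wsqrtr// gerBl sqr_ge0.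
apply/andP; split; rewrite ler_ln ?posrE; lra.
Qed.

(** Extracting [ln K] leaves coefficients that stay bounded as [K] grows, and it cancels in the
    difference between P and Q. *)
Lemma jensenM (k a b : R) : 0 < k -> 0 < Num.max `|a| `|b| ->
  jensen (k * a) (k * b) = ln k + jensen a b.
Proof.
move=> k0 m0; rewrite /jensen -lnM ?posrE ?ltr_wpDr ?sqrtr_ge0//; congr ln.
rewrite !normrM (gtr0_norm k0) -maxr_pMr ?(ltW k0)// mulrDr; congr (_ + _).
by rewrite !exprMn -mulrBr sqrtrM ?sqr_ge0// sqrtr_sqr gtr0_norm.
Qed.

Lemma jensen_cvg (a b d : R) (x : nat -> R) : 0 < b -> x n @[n --> \oo] --> (0 : R) ->
  jensen (a * x n) (b + d * x n) @[n --> \oo] --> ln (2 * b).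
Proof.
move=> b0 x0.
pose G y := ln (b + d * y + Num.sqrt ((b + d * y) ^+ 2 - (a * y) ^+ 2)).
have G0 : G 0 = ln (2 * b).
  rewrite /G !mulr0 addr0 [0 ^+ 2]expr0n/= subr0 sqrtr_sqr gtr0_norm//.
  by congr ln; ring.
have Gc : {for 0, continuous G}.
  apply: continuous_ln_comp; last by rewrite mulr0 addr0 ltr_wpDr ?sqrtr_ge0.
  have c1 : {for 0, continuous (fun y : R => b + d * y)}.
    exact: is_derive1_continuous.
  have c2 : {for 0, continuous (fun y : R =>
      Num.sqrt ((b + d * y) ^+ 2 - (a * y) ^+ 2))}.
    by apply: continuous_sqrt_comp; exact: is_derive1_continuous.
  exact: cvgD c1 c2.
have h : G (x n) @[n --> \oo] --> ln (2 * b).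
  by rewrite -G0; exact: (cvg_comp x G x0 Gc).
apply: cvg_trans h; apply: near_eq_cvg.
have cd : b + d * x n - `|a| * `|x n| @[n --> \oo] --> b.
  rewrite -[X in _ --> X](_ : b + d * 0 - `|a| * `|(0 : R)| = b); last first.
    by rewrite normr0 !mulr0; ring.
  apply: cvgB; first by apply: cvgD; [exact: cvg_cst|exact: cvgMl_tmp].
  by apply: cvgMl_tmp; exact: cvg_norm.
have : \forall n \near \oo, 0 < b + d * x n - `|a| * `|x n|.
  by apply: (cvgr_gt _ cd).
apply: filterS => n hn; rewrite /G jensen_ge// normrM; lra.
Qed.

Lemma acoef_periodic (s : R) : acoef (s + 2 * pi) = acoef s.
Proof.
rewrite /acoef (_ : (s + 2 * pi) / 2 = s / 2 + pi); last by field.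
by rewrite cosDpi sqrrN.
Qed.

(** Translation by [2 pi] changes the sign of [bP], but the Jensen value is even in [b]. *)
Lemma jensen_bP_periodic (k s : R) :
  jensen (acoef (s + 2 * pi)) (bP k (s + 2 * pi)) = jensen (acoef s) (bP k s).
Proof.
rewrite acoef_periodic -[RHS]jensenN /bP (_ : (s + 2 * pi) / 2 = s / 2 + pi); last by field.
by rewrite cosDpi mulrN.
Qed.

Lemma jensen_bQ_periodic (k s : R) :
  jensen (acoef (s + 2 * pi)) (bQ k (s + 2 * pi)) = jensen (acoef s) (bQ k s).
Proof.
rewrite acoef_periodic /bQ (_ : (s + 2 * pi) / 2 = s / 2 + pi); last by field.
have e : (- cos (s / 2)) ^+ 4 = cos (s / 2) ^+ 4 by ring.
by rewrite cosDpi sqrrN e.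
Qed.

Lemma measurable_acoef : measurable_fun setT (@acoef R).
Proof. by apply: continuous_measurable_fun => s; exact: is_derive1_continuous. Qed.

Lemma measurable_bP (k : R) : measurable_fun setT (bP k).
Proof. by apply: continuous_measurable_fun => s; exact: is_derive1_continuous. Qed.

Lemma measurable_bQ (k : R) : measurable_fun setT (bQ k).
Proof. by apply: continuous_measurable_fun => s; exact: is_derive1_continuous. Qed.

Lemma cos_half_bounds (s : R) : `|cos (s / 2)| <= 1 /\ 0 <= cos (s / 2) ^+ 2 <= 1.
Proof.
have h : `|cos (s / 2)| <= 1 by rewrite ler_norml cos_geN1 cos_le1.
by split => //; rewrite sqr_ge0 -real_normK ?num_real// expr_le1.
Qed.

Lemma acoef_le3 (s : R) : `|acoef s| <= 3.
Proof.
have [_ /andP[? ?]] := cos_half_bounds s.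
by rewrite ler_norml /acoef; apply/andP; split; lra.
Qed.

Lemma maxP_bounds (k s : R) : 4 <= k ->
  8^-1 <= Num.max `|acoef s| `|bP k s| <= 3 + k.
Proof.
move=> k4; have [h1 /andP[h2 h3]] := cos_half_bounds s.
have k0 : 0 <= k by lra.
apply/andP; split; last first.
  rewrite ge_max; apply/andP; split; first by have := acoef_le3 s; lra.
  rewrite normrM (ger0_norm k0).
  have : k * `|cos (s / 2)| <= k by rewrite ler_piMr.
  lra.
rewrite le_max; apply/orP.
have [h|h] := leP `|cos (s / 2)| 4^-1.
  left; rewrite -normrN; apply: le_trans (ler_norm _); rewrite /acoef.
  have : cos (s / 2) ^+ 2 <= 4^-1 ^+ 2.
    by rewrite -(real_normK (num_real (cos _))) ler_pXn2r ?nnegrE//; lra.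
  lra.
right; rewrite normrM (ger0_norm k0); nra.
Qed.

(** With t = c^2, a vanishes only at t = 1/4. Up to the cut 7/32, just below, 1 - 4 t is at least
    1/8; beyond it, b_Q >= 8 t^2 + 4 t - 1 exceeds 1/8. *)
Lemma maxQ_bounds (k s : R) : 4 <= k ->
  8^-1 <= Num.max `|acoef s| `|bQ k s| <= 9 + 2 * k.
Proof.
move=> k4; have [_] := cos_half_bounds s; rewrite /acoef /bQ.
have -> : cos (s / 2) ^+ 4 = (cos (s / 2) ^+ 2) ^+ 2 by rewrite -exprM.
move: (cos _ ^+ 2) => t /andP[t0 t1].
apply/andP; split; last first.
  by rewrite ge_max !ler_norml; apply/andP; split; apply/andP; split; nra.
rewrite le_max; apply/orP.
have [h|h] := leP t (32^-1 * 7).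
  left; rewrite -normrN; apply: le_trans (ler_norm _); lra.
right; apply: le_trans (ler_norm _); nra.
Qed.

Lemma jensen_integrable (b : R -> R) (M : R) : measurable_fun setT b ->
  (forall s, 8^-1 <= Num.max `|acoef s| `|b s| <= M) ->
  exists v, has_integral D (fun s => jensen (acoef s) (b s)) v.
Proof.
move=> mb bnd; apply: has_integralP => //.
have Dfin : (mu D < +oo)%E.
  by rewrite lebesgue_measure_itv/=; case: ifP => _; rewrite -?EFinD ltry.
apply: measurable_bounded_integrable => //.
- by apply: measurable_funTS; apply: measurable_jensen => //; exact: measurable_acoef.
have jb s : `|jensen (acoef s) (b s)| <= `|ln 8^-1| + `|ln (2 * M)|.
  have /andP[h1 h2] := bnd s.
  have m8 : 0 < 8^-1 :> R by [].
  have /andP[] := jensen_bounds m8 h1 h2.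
  have := ler_norm (ln (2 * M)); have := ler_norm (- ln (8^-1 : R)); rewrite normrN.
  have := normr_ge0 (ln (2 * M)); have := normr_ge0 (ln (8^-1 : R)).
  by move=> ? ? ? ? ? ?; rewrite ler_norml; apply/andP; split; lra.
exists (`|ln 8^-1| + `|ln (2 * M)|); split; first exact: num_real.
by move=> y hy s _; apply: le_trans (jb s) (ltW hy).
Qed.

(** The bound must be uniform in [K] and integrable up to [s = pi], where c = cos(s/2) tends to 0.
    After division by [K], the maxima lie above c^2 / 4 = (2 + 2 cos s) / 16 and below 1 for P, 4
    for Q; this gives ln 16, ln 2 and ln 8. *)
Lemma jensen_difference_dominated (K s : R) : 16 <= K -> - pi < s < pi ->
  `|jensen (acoef s) (bP K s) - jensen (acoef s) (bQ K s)| <=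
    (ln 2 + ln 8 + ln 16) + 2 * `|ln (2 + 2 * cos s)|.
Proof.
move=> K16 sp; have c0 := cos_half_gt0 sp.
have K0 : 0 < K by lra.
have -> : 2 + 2 * cos s = 4 * cos (s / 2) ^+ 2.
  rewrite -[in LHS](_ : s / 2 *+ 2 = s); last by rewrite -mulr_natr; field.
  by rewrite cos_mulr2n -mulr_natl; ring.
have [_] := cos_half_bounds s; have := acoef_le3 s.
have cle : cos (s / 2) <= 1 by exact: cos_le1.
pose x := K^-1; have Kx : K * x = 1 by rewrite /x mulfV// gt_eqF.
have x0 : 0 < x by rewrite invr_gt0.
have x16 : x <= 16^-1 by rewrite lef_pV2 ?posrE//; lra.
rewrite /acoef /bP /bQ; move: (cos _) c0 cle => c c0 cle a3 /andP[t0 t1].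
have -> : 4 * c ^+ 2 - 1 = K * (x * (4 * c ^+ 2 - 1)) by rewrite [RHS]mulrA Kx mul1r.
have -> : 8 * c ^+ 4 + (2 * K - 4) * c ^+ 2 - 1 =
    K * (2 * c ^+ 2 + x * (8 * (c ^+ 2) ^+ 2 - 4 * c ^+ 2 - 1)).
  rewrite mulrDr [K * (x * _)]mulrA Kx; ring.
have tpos : 0 < c ^+ 2 by rewrite exprn_gt0.
have tc : c ^+ 2 <= c by rewrite expr2 ler_piMr// ltW.
set h := ln (4 * c ^+ 2).
have lnc : ln (c ^+ 2 / 4) = h - ln 16.
  by rewrite -ln_div ?posrE ?mulr_gt0//; congr ln; field.
have m1 : c ^+ 2 / 4 <= Num.max `|x * (4 * c ^+ 2 - 1)| `|c|.
  by rewrite le_max (gtr0_norm c0); apply/orP; right; lra.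
have M1 : Num.max `|x * (4 * c ^+ 2 - 1)| `|c| <= 1.
  rewrite ge_max (gtr0_norm c0) cle andbT normrM (gtr0_norm x0).
  have := normr_ge0 (4 * c ^+ 2 - 1); nra.
have m2 : c ^+ 2 / 4 <= Num.max `|x * (4 * c ^+ 2 - 1)|
    `|2 * c ^+ 2 + x * (8 * (c ^+ 2) ^+ 2 - 4 * c ^+ 2 - 1)|.
  (* The coefficient from [bQ] can vanish only if c^2 < x; then c^2 < 1/16, and the one from [acoef]
     is at least 3 x / 4 in absolute value. *)
  rewrite le_max; apply/orP; have [xc|xc] := leP x (c ^+ 2).
    by right; apply: le_trans (ler_norm _); move: (c ^+ 2) tpos t1 xc => t ? ? ?; nra.
  by left; rewrite -normrN; apply: le_trans (ler_norm _);
    move: (c ^+ 2) tpos t1 xc => t ? ? ?; nra.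
have M2 : Num.max `|x * (4 * c ^+ 2 - 1)|
    `|2 * c ^+ 2 + x * (8 * (c ^+ 2) ^+ 2 - 4 * c ^+ 2 - 1)| <= 4.
  rewrite ge_max; apply/andP; split.
    rewrite normrM (gtr0_norm x0).
    have := normr_ge0 (4 * c ^+ 2 - 1); nra.
  by move: (c ^+ 2) tpos t1 => t ? ?; rewrite ler_norml; apply/andP; split; nra.
have p4 : 0 < c ^+ 2 / 4 by rewrite divr_gt0.
have n1 := lt_le_trans p4 m1; have n2 := lt_le_trans p4 m2.
rewrite !jensenM//.
have /andP[] := jensen_bounds p4 m1 M1; have /andP[] := jensen_bounds p4 m2 M2.
rewrite lnc mulr1 (_ : 2 * 4 = 8); last by ring.
have := ler_norm h; have := ler_norm (- h); rewrite normrN.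
have l2 : 0 <= ln 2 :> R by apply: ln_ge0; lra.
have l8 : 0 <= ln 8 :> R by apply: ln_ge0; lra.
have l16 : 0 <= ln 16 :> R by apply: ln_ge0; lra.
by move=> ? ? ? ? ? ?; rewrite ler_norml; apply/andP; split; lra.
Qed.

Lemma jensen_difference_cvg (x : nat -> R) (s : R) : - pi < s < pi ->
  (forall n, 0 < x n) -> x n @[n --> \oo] --> (0 : R) ->
  jensen (acoef s) (bP (x n)^-1 s) - jensen (acoef s) (bQ (x n)^-1 s)
    @[n --> \oo] --> - 2^-1 * ln (2 + 2 * cos s).
Proof.
move=> sp x0 xcvg; have c0 := cos_half_gt0 sp.
have -> : 2 + 2 * cos s = 4 * cos (s / 2) ^+ 2.
  rewrite -[in LHS](_ : s / 2 *+ 2 = s); last by rewrite -mulr_natr; field.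
  by rewrite cos_mulr2n -mulr_natl; ring.
rewrite /bP /bQ; set a := acoef s; move: (cos _) c0 => c c0.
have c20 : 0 < 2 * c ^+ 2 by rewrite mulr_gt0// exprn_gt0.
have h : jensen (a * x n) (c + 0 * x n) - jensen (a * x n)
      (2 * c ^+ 2 + (8 * c ^+ 4 - 4 * c ^+ 2 - 1) * x n) @[n --> \oo] -->
    ln (2 * c) - ln (2 * (2 * c ^+ 2)).
  by apply: cvgB; apply: jensen_cvg.
rewrite (_ : ln (2 * c) - _ = - 2^-1 * ln (4 * c ^+ 2)) in h; last first.
  rewrite (_ : 2 * (2 * c ^+ 2) = (2 * c) ^+ 2); last by ring.
  rewrite (_ : 4 * c ^+ 2 = (2 * c) ^+ 2); last by ring.
  by rewrite lnXn ?mulr_gt0// -mulr_natl; field.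
apply: cvg_trans h; apply: near_eq_cvg.
have cx : 2 * c ^+ 2 + (8 * c ^+ 4 - 4 * c ^+ 2 - 1) * x n @[n --> \oo] --> 2 * c ^+ 2.
  rewrite -[X in _ --> X](_ : 2 * c ^+ 2 + (8 * c ^+ 4 - 4 * c ^+ 2 - 1) * 0 = _);
    last by rewrite mulr0 addr0.
  by apply: cvgD; [exact: cvg_cst|exact: cvgMl_tmp].
have : \forall n \near \oo, 0 < 2 * c ^+ 2 + (8 * c ^+ 4 - 4 * c ^+ 2 - 1) * x n.
  by apply: (cvgr_gt _ cx).
apply: filterS => n hn.
have xn0 : x n != 0 by rewrite gt_eqF.
have V0 : 0 < (x n)^-1 by rewrite invr_gt0.
have J1 : jensen a ((x n)^-1 * c) = ln (x n)^-1 + jensen (a * x n) (c + 0 * x n).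
  rewrite -jensenM//; first by congr jensen; field.
  by rewrite lt_max !normr_gt0 mul0r addr0 (gt_eqF c0) orbT.
have J2 : jensen a (8 * c ^+ 4 + (2 * (x n)^-1 - 4) * c ^+ 2 - 1) =
    ln (x n)^-1 + jensen (a * x n) (2 * c ^+ 2 + (8 * c ^+ 4 - 4 * c ^+ 2 - 1) * x n).
  rewrite -jensenM//; first by congr jensen; field.
  by rewrite lt_max !normr_gt0 (gt_eqF hn) orbT.
by rewrite J1 J2; ring.
Qed.

(** Since the increments agree, the difference at each [K n] equals [vP - vQ]: dominated convergence
    is applied to a constant sequence of integrals. *)
Lemma jensen_integrals_eq (k vP vQ : R) : 4 <= k ->
  has_integral D (fun s => jensen (acoef s) (bP k s)) vP ->
  has_integral D (fun s => jensen (acoef s) (bQ k s)) vQ -> vP = vQ.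
Proof.
move=> k4 hP hQ.
(* [K n] must exceed [k] for the increment formula and be at least 16 for the domination. *)
pose K n : R := k + 16 + n%:R.
have Kk n : k < K n by rewrite /K; have := ler0n R n; lra.
have K16 n : 16 <= K n by rewrite /K; have := ler0n R n; lra.
have K0 n : 0 < K n by have := K16 n; lra.
have K4 n : 4 <= K n by have := K16 n; lra.
have diff n : has_integral D (fun s =>
    jensen (acoef s) (bP (K n) s) - jensen (acoef s) (bQ (K n) s)) (vP - vQ).
  have [wP hPn] := jensen_integrable (measurable_bP (K n)) (fun s => maxP_bounds s (K4 n)).
  have [wQ hQn] := jensen_integrable (measurable_bQ (K n)) (fun s => maxQ_bounds s (K4 n)).
  have [_ e1] := has_integralD (measurable_itv _) hPn (has_integralN (measurable_itv _) hP).
  have [_ e2] := has_integralD (measurable_itv _) hQn (has_integralN (measurable_itv _) hQ).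
  have := integral_jensen_increment_PQ k4 (Kk n); rewrite e1 e2 => -[e].
  have -> : vP - vQ = wP - wQ by lra.
  exact: has_integralD (has_integralN _ hQn).
have xcvg : (K n)^-1 @[n --> \oo] --> (0 : R).
  apply/cvgrPdist_le => e e0; near=> n.
  have V0 : 0 <= (K n)^-1 by rewrite invr_ge0 ltW.
  rewrite sub0r normrN ger0_norm//; apply: (@le_trans _ _ n.+1%:R^-1).
    by rewrite lef_pV2 ?posrE// /K -natr1; lra.
  apply: ltW; near: n; exact: (near_infty_natSinv_lt (PosNum e0)).
have hlim : has_integral D (fun s : R => ln (2 + 2 * cos s)) 0.
  apply: has_integral_centered ln_1Dcos_has_integral.
  by apply: measurable_ln_smooth => x; exact: is_derive1_continuous.
  by move=> x; rewrite cosD2pi_mul.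
have mh : measurable_fun setT (fun s : R => ln (2 + 2 * cos s)).
  by apply: measurable_ln_smooth => x; exact: is_derive1_continuous.
pose g (s : R) := (ln 2 + ln 8 + ln 16) + 2 * `|ln (2 + 2 * cos s)| : R.
have [v [gi _]] : exists v, has_integral D g v.
  have [w hw] : exists w, has_integral I (fun s : R => `|ln (2 + 2 * cos s)|) w.
    apply: has_integralP => //; have [hi _] := @ln_1Dcos_has_integral R.
    have := integrable_abse hi; by apply: (@eq_integrable _ _ _ mu I).
  have gI := has_integralD (measurable_itv _)
    (has_integral_cst (ln 2 + ln 8 + ln 16) (ltW (@twopi_gt0 R)))
    (has_integralZ 2 (measurable_itv _) hw).
  eexists; apply: has_integral_centered gI.
    apply: measurable_funD => //; apply: measurable_funM => //.
    by apply: measurableT_comp mh; exact: normr_measurable.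
  by move=> x; rewrite /g cosD2pi_mul.
have mj n : measurable_fun setT (fun s : R =>
    jensen (acoef s) (bP (K n) s) - jensen (acoef s) (bQ (K n) s)).
  apply: measurable_funB; apply: measurable_jensen.
  - exact: measurable_acoef.
  - exact: measurable_bP.
  - exact: measurable_acoef.
  - exact: measurable_bQ.
pose f_ n (s : R) :=
  (jensen (acoef s) (bP (K n) s) - jensen (acoef s) (bQ (K n) s))%:E.
pose f (s : R) := (- 2^-1 * ln (2 + 2 * cos s))%:E.
have mf_ n : measurable_fun D (f_ n).
  by apply/measurable_EFinP; apply: measurable_funTS; exact: mj.
have mf : measurable_fun D f.
  by apply/measurable_EFinP; apply: measurable_funTS; exact: measurable_funM.
have cf : {ae mu, forall s, D s -> f_ ^~ s @ \oo --> f s}.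
  apply: aeW => s; rewrite /= in_itv/= => sp.
  apply: cvg_EFin; first by near=> n.
  have V0 n : 0 < (K n)^-1 by rewrite invr_gt0.
  have := jensen_difference_cvg sp V0 xcvg.
  by under eq_fun do rewrite invrK.
have bf : {ae mu, forall s n, D s -> (`|f_ n s| <= (EFin \o g) s)%E}.
  apply: aeW => s n; rewrite /= in_itv/= => sp.
  by rewrite lee_fin; exact: jensen_difference_dominated.
case: (@dominated_convergence _ _ _ mu D (measurable_itv _) f_ f (EFin \o g)
  mf_ mf cf gi bf) => _ _.
have [_ ->] := has_integralZ (- 2^-1) (measurable_itv _) hlim.
have -> : [sequence (\int[mu]_(s in D) f_ n s)%E]_n = (fun=> (vP - vQ)%:E).
  by apply/funext => n; case: (diff n).
move=> /(cvg_unique (@ereal_hausdorff R) (cvg_cst _)) => -[].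
lra.
Unshelve. all: by end_near. Qed.

Lemma integral_jensen_eq (k : R) : 4 <= k ->
  (\int[mu]_(s in I) (jensen (acoef s) (bP k s) * (2 * pi))%:E =
   \int[mu]_(s in I) (jensen (acoef s) (bQ k s) * (2 * pi))%:E)%E.
Proof.
move=> k4.
have mP : measurable_fun setT (fun s : R => jensen (acoef s) (bP k s) * (2 * pi)).
  apply: measurable_funM => //; apply: measurable_jensen; [exact: measurable_acoef|].
  exact: measurable_bP.
have mQ : measurable_fun setT (fun s : R => jensen (acoef s) (bQ k s) * (2 * pi)).
  apply: measurable_funM => //; apply: measurable_jensen; [exact: measurable_acoef|].
  exact: measurable_bQ.
rewrite integral_periodic_centered; [|exact/measurable_EFinP|
  by move=> x; rewrite jensen_bP_periodic].
rewrite [RHS]integral_periodic_centered; [|exact/measurable_EFinP|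
  by move=> x; rewrite jensen_bQ_periodic].
have [vP hP] := jensen_integrable (measurable_bP k) (fun s => maxP_bounds s k4).
have [vQ hQ] := jensen_integrable (measurable_bQ k) (fun s => maxQ_bounds s k4).
have PQ := jensen_integrals_eq k4 hP hQ.
under eq_integral do rewrite mulrC.
under [RHS]eq_integral do rewrite mulrC.
have [_ ->] := has_integralZ (2 * pi) (measurable_itv _) hP.
have [_ ->] := has_integralZ (2 * pi) (measurable_itv _) hQ.
by rewrite PQ.
Qed.

End Conclusion.

Unset Implicit Arguments.

Theorem theorem1 (R : realType) (k : R) (hk : 4 <= k) :
  mahler (Pk k) = mahler (Qk (k + 2)).
Proof.
have pi0 := pi_gt0 R.
have m8 : 0 < (8^-1 : R) by [].
have ab (b : R -> R) M : (forall s, 8^-1 <= Num.max `|acoef s| `|b s| <= M) ->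
    forall s, (acoef s != 0) || (b s != 0).
  move=> h s; have /andP[+ _] := h s; move/(lt_le_trans m8).
  by rewrite lt_max !normr_gt0.
have abM (b : R -> R) M : (forall s, 8^-1 <= Num.max `|acoef s| `|b s| <= M) ->
    forall s, 2 * `|acoef s| + 2 * `|b s| <= 4 * M.
  move=> h s; have /andP[_] := h s; rewrite ge_max => /andP[? ?]; lra.
have jm (b : R -> R) M : (forall s, 8^-1 <= Num.max `|acoef s| `|b s| <= M) ->
    forall s, ln 8^-1 <= jensen (acoef s) (b s).
  by move=> h s; have /andP[h1 h2] := h s; have /andP[] := jensen_bounds m8 h1 h2.
have hP s := @maxP_bounds R k s hk.
have hQ s := @maxQ_bounds R k s hk.
(* The phase is [s / 2] for P and [s] for Q. The upper bounds use 2 |a| + 2 |b| <= 4 max(|a|, |b|),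
   the lower bound [ln 8^-1] the uniform minorant of that maximum. *)
rewrite (@mahler_jensen _ (Pk k) (@acoef R) (bP k) (fun s => s / 2) (4 * (3 + k)) (ln 8^-1)).
- rewrite (@mahler_jensen _ (Qk (k + 2)) (@acoef R) (bQ k) id (4 * (9 + 2 * k)) (ln 8^-1)).
  + by rewrite integral_jensen_eq.
  + by move=> s t; exact: cabs_Qk.
  + exact: measurable_acoef.
  + exact: measurable_bQ.
  + exact: measurable_id.
  + by move=> s /=; rewrite in_itv/=.
  + exact: ab hQ.
  + lra.
  + exact: abM hQ.
  + exact: jm hQ.
- by move=> s t; exact: cabs_Pk.
- exact: measurable_acoef.
- exact: measurable_bP.
- exact: mulrr_measurable.
- by move=> s /=; rewrite in_itv/= => /andP[? ?]; apply/andP; split; lra.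
- exact: ab hP.
- lra.
- exact: abM hP.
- exact: jm hP.
Qed.
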